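(* Let $(X_t)_{t\ge0}$ be a Lévy process as in the context, with Lévy measure $\nu$ satisfying $r_\nu>0$, $r_\nu^*=+\infty$ and the growth condition (G) of the context, and suppose there are $B\in\,]0,B_\nu[$ and $\kappa>0$ for which the zero condition (Z) of the context holds. Suppose that $\mathbb E(X_1)>0$. Let $$A_x(t)=\mathbb P\left(\frac1{\sqrt x}\Big(T_x+\frac{x}{\varphi'(-\gamma_0(0))}\Big)\le t\right),\qquad t\in\mathbb R,$$ and let $A$ be the distribution function of the Gaussian law with mean $0$ and variance $-\frac{\varphi''(-\gamma_0(0))}{\varphi'(-\gamma_0(0))^3}$. Then there exists $k_3>0$ such that $$\sup_{t\in\mathbb R}|A_x(t)-A(t)|\le\frac{k_3}{x^{1/4}}\qquad\text{for all }x\ge1 .$$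
   Context: $(X_t)_{t\ge0}$ is a real Lévy process started at $0$ with decomposition $X_t=B_t-ct+J_t$, where $B$ is a standard Brownian motion, $c\in\mathbb R$, and $J$ is a pure jump Lévy process independent of $B$ with Lévy measure $\nu$. Its exponent is normalized by $\mathbb E(e^{-qX_t})=e^{t\varphi(q)}$ with $$\varphi(q)=\frac{q^2}{2}+cq+\int_{\mathbb R}\big(e^{-qy}-1+qy\,\mathbf 1_{\{|y|<1\}}\big)\nu(dy).$$ For $x\ge0$: $T_x=\inf\{t\ge0: X_t>x\}$. Define $r_\nu=\sup\{s\ge0:\int_1^{+\infty}e^{sy}\nu(dy)<+\infty\}\in[0,+\infty]$ and $r_\nu^*=\sup\{q\in\mathbb R:\int_{-\infty}^{-1}e^{-qy}\nu(dy)<+\infty\}$ (with $\sup\emptyset=0$). When $r_\nu>0$ and $r_\nu^*=+\infty$, $\varphi$ is defined on $]-r_\nu,+\infty[$ and $\mathbb E|X_1|<\infty$. Let $D_b=\{q\in\mathbb C:\Re q>-b\}$, $\widehat{\nu_{|[1,+\infty[}}(q)=\int_1^{+\infty}e^{-qy}\nu(dy)$, and $B_\nu=\sup\{b>0:\ \widehat{\nu_{|[1,+\infty[}}\text{ admits a meromorphic extension to }D_b\}$. Then $B_\nu\ge r_\nu$ ($B_\nu=+\infty$ allowed) and $\varphi$ has a meromorphic extension to $D_{B_\nu}$; the extensions are denoted by the same symbols. For $\theta\ge0$, $\varphi_\theta=\varphi-\theta$. Growth condition (G): for every $B\in\,]0,B_\nu[$ there exist $K>0$ and $R_0>0$ such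 that $|\widehat{\nu_{|[1,+\infty[}}(q)|\le K|q|$ for every $q$ with $-B\le\Re q\le0$ and $|\Im q|\ge R_0$. Zero condition (Z) for $B\in\,]0,B_\nu[$ and $\kappa>0$: for every $\theta\in[0,\kappa]$, (a) there is a real $-\gamma_0(\theta)\in\,]-r_\nu,0]$ with $\varphi(-\gamma_0(\theta))=\theta$, where $-\gamma_0(\theta)<0$ if $\theta>0$, $-\gamma_0(0)<0$ if $\mathbb E(X_1)<0$, and $-\gamma_0(0)=0$ if $\mathbb E(X_1)\ge0$; (b) there is $\beta_\theta>0$ such that the set of zeros of $\varphi_\theta$ in $\{-B\le\Re q\le\beta_\theta\}$ is $\{-\gamma_0(\theta),-\gamma_1(\theta),-\overline{\gamma_1}(\theta),\dots,-\gamma_p(\theta),-\overline{\gamma_p}(\theta)\}$, together with the additional zero $0$ when $\theta=0$ and $\mathbb E(X_1)<0$, where $-B<-\Re(\gamma_p(\theta))\le\cdots\le-\Re(\gamma_1(\theta))<-\gamma_0(\theta)\le0$ and $p$ does not depend on $\theta\in[0,\kappa]$. *)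

(* Defs.v *)
From HB Require Import structures.
From mathcomp Require Import all_boot all_order all_algebra.
From mathcomp Require Import all_classical all_reals all_analysis.
From mathcomp Require Import complex.

Set Implicit Arguments.
Unset Strict Implicit.
Unset Printing Implicit Defensive.
Import Order.TTheory GRing.Theory Num.Theory.
Import numFieldNormedType.Exports.

Local Open Scope classical_set_scope.
Local Open Scope ring_scope.
Local Open Scope complex_scope.

(* R[i] seen as a numFieldType, so that it gets the canonical topology given by
   the modulus, and derivability over itself. *)
Definition cplx (R : realType) : numFieldType := R[i].

Definition cexp (R : realType) (z : cplx R) : cplx R :=
  (expR (complex.Re z))%:C * (cos (complex.Im z) +i* sin (complex.Im z)).

Definition cintegral d (T : measurableType d) (R : realType)
    (mu : {measure set T -> \bar R}) (D : set T) (f : T -> cplx R) : cplx R :=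
  (\int[mu]_(x in D) complex.Re (f x)) +i* (\int[mu]_(x in D) complex.Im (f x)).

(* {q | Re q > - b}, where b = +oo is allowed *)
Definition half_plane (R : realType) (b : \bar R) : set (cplx R) :=
  [set q | (- b < (complex.Re q)%:E)%E].

(* The values of mero_val on the set of poles are junk. *)
Record merofun (R : realType) := Merofun {
  mero_val :> cplx R -> cplx R;
  poles : set (cplx R) }.

(* For U open. The poles do not accumulate in U, so the derivability clause is
   holomorphy on the open set of the non-poles; every element of poles f is a
   genuine pole, of order n.+1, and not a removable singularity. *)
Definition meromorphic_on (R : realType) (U : set (cplx R)) (f : merofun R) :=
  [/\ poles f `<=` U,
      forall q, U q -> \forall w \near q^', ~ poles f w,
      forall q, U q -> ~ poles f q -> derivable f q 1
    & forall q, poles f q -> exists (n : nat) (l : cplx R), l != 0 /\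
        (w - q) ^+ n.+1 * f w @[w --> q^'] --> l].

(* F extends to U (or restricts to U, if U is smaller than V) the function f,
   holomorphic on V. *)
Definition meromorphic_extension (R : realType) (V : set (cplx R))
    (f : cplx R -> cplx R) (U : set (cplx R)) (F : merofun R) :=
  meromorphic_on U F /\
  forall q, U q -> V q -> ~ poles F q /\ F q = f q.

Section levy_measure.
Context (R : realType).
Implicit Types (nu : {measure set (measurableTypeR R) -> \bar R}) (c : R).

Definition levy_measure nu :=
  nu [set 0] = 0%E /\ (\int[nu]_y (Num.min 1 (y ^+ 2))%:E < +oo)%E.

Definition r_nu nu : \bar R :=
  ereal_sup [set s%:E | s in [set s : R | 0 <= s /\
    (\int[nu]_(y in `[1%R, +oo[) (expR (s * y))%:E < +oo)%E]].

(* q = 0 belongs to the set when nu is a Levy measure, so that the value of the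
   supremum of the empty set is irrelevant. *)
Definition r_nu_star nu : \bar R :=
  ereal_sup [set q%:E | q in [set q : R |
    (\int[nu]_(y in `]-oo, (- 1)%R]) (expR (- q * y))%:E < +oo)%E]].

Definition jump_exponent nu (q : cplx R) : cplx R :=
  cintegral nu setT
    (fun y : R => cexp (- q * y%:C) - 1 + q * (y * (`|y| < 1)%R%:R)%:C).

(* The exponent phi on the complex half-plane of convergence... *)
Definition cphi c nu (q : cplx R) : cplx R :=
  q ^+ 2 / 2 + c%:C * q + jump_exponent nu q.

(* ... and its restriction to the reals, see cphi_real. *)
Definition phi c nu (q : R) : R :=
  q ^+ 2 / 2 + c * q +
  \int[nu]_y (expR (- q * y) - 1 + q * (y * (`|y| < 1)%R%:R)).

Lemma cphi_real c nu (q : R) : cphi c nu q%:C = (phi c nu q)%:C.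
Proof.
have integrandE (y : R) :
    cexp (- q%:C * y%:C) - 1 + q%:C * (y * (`|y| < 1)%R%:R)%:C =
    (expR (- q * y) - 1 + q * (y * (`|y| < 1)%R%:R))%:C.
  have -> : - q%:C * y%:C = (- q * y)%:C by rewrite rmorphM rmorphN.
  rewrite /cexp /= cos0 sin0.
  have -> : (1 +i* 0 : R[i]) = 1 by [].
  by rewrite mulr1 !(rmorphD, rmorphN, rmorphM, rmorph1).
rewrite /cphi /phi /jump_exponent /cintegral.
under eq_fun do rewrite integrandE.
under [X in _ +i* Rintegral _ _ X]eq_fun do rewrite integrandE.
rewrite /=.
have -> : \int[nu]_y (0 : R) = 0 by rewrite /Rintegral integral0.
by rewrite !rmorphD !rmorphM /= fmorphV rmorph_nat.
Qed.

Definition laplace_ge1 nu (q : cplx R) : cplx R :=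
  cintegral nu `[1, +oo[ (fun y : R => cexp (- q * y%:C)).

Definition B_nu nu : \bar R :=
  ereal_sup [set b%:E | b in [set b : R | 0 < b /\ exists F : merofun R,
    meromorphic_extension (half_plane (r_nu nu)) (laplace_ge1 nu)
      (half_plane b%:E) F]].

(* nuhat is the extension of laplace_ge1 nu to half_plane (B_nu nu). *)
Definition growth_condition nu (nuhat : merofun R) :=
  forall B : R, 0 < B -> (B%:E < B_nu nu)%E ->
  exists K R0 : R, [/\ 0 < K, 0 < R0 &
    forall q : cplx R, - B <= complex.Re q <= 0 -> R0 <= `|complex.Im q| ->
      ~ poles nuhat q /\ `|nuhat q| <= K%:C * `|q|].

(* phihat is the extension of cphi c nu to half_plane (B_nu nu), EX1 the mean of
   X_1. The family gamma_1, ..., gamma_p is indexed from 0. *)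
Definition zero_condition c nu (phihat : merofun R) (EX1 : \bar R)
    (B kappa : R) (gamma0 : R -> R) :=
  exists p : nat, forall theta : R, 0 <= theta <= kappa ->
  [/\ [/\ (- r_nu nu < (- gamma0 theta)%:E)%E, - gamma0 theta <= 0
        & phi c nu (- gamma0 theta) = theta],
      [/\ 0 < theta -> - gamma0 theta < 0,
          theta = 0 -> (EX1 < 0)%E -> - gamma0 theta < 0
        & theta = 0 -> (0 <= EX1)%E -> - gamma0 theta = 0]
    & exists (beta : R) (gamma : 'I_p -> cplx R),
      [/\ 0 < beta,
          - B < - gamma0 theta,
          forall i, - B < - complex.Re (gamma i) < - gamma0 theta,
          forall i j : 'I_p, (i <= j)%N ->
            - complex.Re (gamma j) <= - complex.Re (gamma i)
        & [set q : cplx R | [/\ - B <= complex.Re q <= beta,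
             ~ poles phihat q & phihat q - theta%:C = 0]] =
          [set (- gamma0 theta)%:C] `|`
          [set - gamma i | i in setT] `|`
          [set - conjc (gamma i) | i in setT] `|`
          [set q | [/\ q = 0, theta = 0 & (EX1 < 0)%E]]]].

End levy_measure.

Section levy_process.
Context d (T : measurableType d) (R : realType) (P : probability T R).
Implicit Types (X Bm J : R -> T -> R) (c : R).
Implicit Types nu : {measure set (measurableTypeR R) -> \bar R}.

(* Processes are indexed by R, but only the times t >= 0 are meaningful. *)

(* The sigma-algebra generated by the X_t, t in I *)
Definition process_sigma X (I : set R) : set (set T) :=
  <<s [set E | exists t (A : set R), [/\ I t, measurable A & E = X t @^-1` A]] >>.

Definition independent_processes X Y :=
  forall E F, process_sigma X `[0, +oo[ E -> process_sigma Y `[0, +oo[ F ->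
    P (E `&` F) = (P E * P F)%E.

Definition cadlag (f : R -> R) :=
  (forall t, 0 <= t -> f u @[u --> t^'+] --> f t) /\
  (forall t, 0 < t -> cvg (f u @[u --> t^'-])).

Definition levy_process X :=
  [/\ forall t, 0 <= t -> measurable_fun setT (X t),
      forall w, X 0 w = 0,
      forall w, cadlag (X ^~ w),
      forall s t E (A : set R), 0 <= s -> s <= t -> process_sigma X `[0, s] E ->
        measurable A ->
        P (E `&` (X t \- X s) @^-1` A) = (P E * P ((X t \- X s)%R @^-1` A))%E
    & forall s t (A : set R), 0 <= s -> 0 <= t -> measurable A ->
        P ((X (s + t) \- X s) @^-1` A) = P (X t @^-1` A)].

Definition brownian_motion Bm :=
  [/\ levy_process Bm,
      forall w, {within `[0, +oo[, continuous (Bm ^~ w)}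
    & forall t (A : set R), 0 < t -> measurable A ->
        P (Bm t @^-1` A) = normal_prob 0 (Num.sqrt t) A].

(* Neither Gaussian part nor drift: Levy-Khintchine formula for the
   characteristic function, with q = - i u *)
Definition pure_jump_levy_process nu J :=
  levy_process J /\
  forall t (q : cplx R), 0 <= t -> complex.Re q = 0 ->
    cintegral P setT (fun w => cexp (- q * (J t w)%:C)) =
    cexp (t%:C * jump_exponent nu q).

Definition levy_decomposition X Bm c J nu :=
  [/\ levy_process X,
      brownian_motion Bm,
      pure_jump_levy_process nu J,
      independent_processes Bm J
    & forall t w, 0 <= t -> X t w = Bm t w - c * t + J t w].

(* Normalization of the exponent, on the real interval where phi is defined
   when r_nu_star nu = +oo *)
Definition has_exponent X c nu :=
  forall t q : R, 0 <= t -> (- r_nu nu < q%:E)%E ->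
    ('E_P[fun w => expR (- q * X t w)%R])%E = (expR (t * phi c nu q))%:E.

Definition hitting_time X (x : R) (w : T) : \bar R :=
  ereal_inf [set t%:E | t in [set t | 0 <= t /\ x < X t w]].

End levy_process.

(* Main.v *)
Require Import Defs.
From mathcomp Require Import all_boot all_order all_algebra.
From mathcomp Require Import all_classical all_reals all_analysis.
From mathcomp Require Import complex.
From mathcomp Require Import ring lra.
From mathcomp Require Import measurable_realfun.
Set Implicit Arguments.
Unset Strict Implicit.
Unset Printing Implicit Defensive.
Import Order.TTheory GRing.Theory Num.Theory.
Import numFieldNormedType.Exports.
Local Open Scope classical_set_scope.
Local Open Scope ring_scope.

(** Since E X_1 > 0, the root - gamma0 0 is 0, and the statement is a central
    limit theorem with rate for the first passage of a process with positive
    drift m = E X_1 = - phi'(0) and variance phi''(0) per unit of time. It is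
    deduced from a Berry-Esseen bound for X_n at integer times n.

    Berry-Esseen ([levy_berry_esseen]). Write X_n = B_n + S_n + n m, where
    S_n = J_n - (c + m) n is a centered random walk independent of the normal
    variable B_n of variance n. Then P(X_n <= y) is the expectation of
    Phi((z - S_n) / sqrt n) with z = y - n m: the Brownian part already smooths
    the indicator, so that the steps of the walk can be replaced one at a time
    by Gaussian ones in the manner of Lindeberg ([lindeberg]), each at a cost
    O(n^(-3/2)) by a third-order Taylor expansion of Phi. No Fourier inversion
    is involved, and the error is O(n^(-1/2)). The moments of the walk come from
    E exp(- q X_1) = exp(phi q) for q near 0: dividing out the Gaussian factor
    exp(q^2/2) gives the exponential moments of S_1, and differentiating twice
    at 0 identifies Var S_1 = phi''(0) - 1.

    First passage ([hitting_lower], [hitting_upper]). If X_n > x then T_x <= n.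
    Conversely, if T_x < N but X_N <= x - a, then the process falls by at least
    a after its first passage above x; choosing q > 0 with phi q <= 0, which
    exists because phi'(0) < 0, the increments satisfy
    P(X_t - X_s <= - a) <= exp(- q a), and conditioning on the first passage
    over a dyadic grid bounds this event by exp(- q a) uniformly in N.

    Inversion ([first_passage_rate]). Put r = x^(1/8), so that the target error
    is 1/r^2, and take a = r^2. For |t| <= r, at integer times within 1 of
    x/m + t sqrt x, the normalized gap between m n and x differs from the
    normalized t by O(1/r^2), and Phi is Lipschitz. For |t| > r both distribution
    functions are monotone and within O(1/r^2) of 0 or 1 already at t = - r or
    t = r, by the Gaussian tail. *)

(** * Taylor estimates and the standard normal distribution *)

Section taylor.
Context {R : realType}.
Implicit Types (f : R -> R) (x h K : R).

(** The mean value theorem with a base point and a signed increment, in the form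
    in which it is iterated by the Taylor estimates. *)
Lemma mvt_global f f' : (forall x, is_derive x 1 f (f' x)) ->
  forall x h, exists2 c, `|c - x| <= `|h| & f (x + h) - f x = f' c * h.
Proof.
move=> df x h.
have cf a b : {within `[a, b], continuous f}.
  by apply: derivable_within_continuous => y _; have ? := df y; exact: ex_derive.
have [h0|h0] := leP 0 h.
  have [|c] := @MVT_segment R f f' x (x + h) _ (fun y _ => df y) (cf _ _).
    by rewrite lerDl.
  rewrite in_itv/= => /andP[c1 c2] e; exists c.
    by rewrite !ger0_norm ?subr_ge0// lerBlDl.
  by rewrite e; congr (_ * _); ring.
have [|c] := @MVT_segment R f f' (x + h) x _ (fun y _ => df y) (cf _ _).
  by rewrite gerDl ltW.
rewrite in_itv/= => /andP[c1 c2] e; exists c.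
  by rewrite ler0_norm ?subr_le0// ltr0_norm//; lra.
have -> : f (x + h) - f x = - (f x - f (x + h)) by ring.
by rewrite e; ring.
Qed.

Lemma taylor1 f f' K : (forall x, is_derive x 1 f (f' x)) ->
  (forall x, `|f' x| <= K) -> forall x h, `|f (x + h) - f x| <= K * `|h|.
Proof.
move=> df f'K x h; have [c _ ->] := mvt_global df x h.
by rewrite normrM ler_wpM2r.
Qed.

Lemma taylor2 f f' f'' K : (forall x, is_derive x 1 f (f' x)) ->
  (forall x, is_derive x 1 f' (f'' x)) -> (forall x, `|f'' x| <= K) ->
  forall x h, `|f (x + h) - f x - h * f' x| <= K * `|h| ^+ 2.
Proof.
move=> df df' f'K x h; have [c ch ->] := mvt_global df x h.
have -> : f' c * h - h * f' x = (f' (x + (c - x)) - f' x) * h.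
  by rewrite [x + _]addrC subrK; ring.
rewrite normrM expr2 mulrA ler_wpM2r//.
apply: (le_trans (taylor1 df' f'K _ _)).
by rewrite ler_wpM2l// (le_trans _ (f'K 0)).
Qed.

(** The constants here and in [taylor2] are not optimal (1/2 and 1/6 would do):
    each order is obtained from the previous one by the mean value theorem. *)
Lemma taylor3 f f' f'' f''' K : (forall x, is_derive x 1 f (f' x)) ->
  (forall x, is_derive x 1 f' (f'' x)) ->
  (forall x, is_derive x 1 f'' (f''' x)) -> (forall x, `|f''' x| <= K) ->
  forall x h, `|f (x + h) - f x - h * f' x - h ^+ 2 / 2 * f'' x| <= K * `|h| ^+ 3.
Proof.
move=> df df' df'' f'K x h.
pose r (y : R) := f y - (y - x) * f' x - (y - x) ^+ 2 / 2 * f'' x.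
have dr (y : R) : is_derive y (1 : R) r (f' y - f' x - (y - x) * f'' x).
  rewrite /r.
  have := df y => ?.
  apply: is_derive_eq.
  rewrite /GRing.scale/=; lra.
have [c ch e] := mvt_global dr x h.
have -> : f (x + h) - f x - h * f' x - h ^+ 2 / 2 * f'' x = r (x + h) - r x.
  by rewrite /r; lra.
rewrite e normrM exprSr mulrA ler_wpM2r//.
have -> : f' c - f' x = f' (x + (c - x)) - f' x by rewrite [x + _]addrC subrK.
apply: (le_trans (taylor2 df' df'' f'K _ _)).
rewrite ler_wpM2l// ?(le_trans _ (f'K 0))//.
by rewrite lerXn2r ?nnegrE.
Qed.

End taylor.

Section normal.
Context {R : realType}.
Implicit Types (z s h a : R).
Notation mu := (@lebesgue_measure R).

Definition npdf z : R := normal_pdf 0 1 z.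
Definition ncdf z : R := fine (normal_prob 0 1 `]-oo, z]).

Lemma npdfE z : npdf z = normal_peak 1 * expR (- (z ^+ 2 / 2)).
Proof.
rewrite /npdf normal_pdfE ?oner_neq0// /normal_fun subr0 expr1n.
by rewrite mulNr.
Qed.

Lemma npdf_ge0 z : 0 <= npdf z.
Proof. exact: normal_pdf_ge0. Qed.

Lemma normal_peak1_le1 : normal_peak 1 <= 1 :> R.
Proof.
rewrite /normal_peak expr1n mul1r invf_le1; last first.
  by rewrite sqrtr_gt0 mulrn_wgt0// pi_gt0.
rewrite -[leLHS]sqrtr1 ler_wsqrtr//.
by have := @pi_ge2 R; rewrite mulr2n; lra.
Qed.

(** exp(-z^2/2) = exp(-z^2/4)^2 <= (1 + z^2/4)^(-2), which absorbs every power of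
    z up to the fourth. This one bound controls all the derivatives of the normal
    distribution function that occur below. *)
Lemma npdf_bound k z : (k <= 4)%N -> `|z| ^+ k * npdf z <= 16.
Proof.
move=> k4.
have zk : `|z| ^+ k <= 1 + z ^+ 4.
  have -> : z ^+ 4 = `|z| ^+ 4 by rewrite -normrX ger0_norm// exprn_even_ge0.
  have [z1|z1] := leP `|z| 1.
    rewrite (le_trans (exprn_ile1 _ (normr_ge0 z) z1))// lerDl; exact: exprn_ge0.
  rewrite (@le_trans _ _ (`|z| ^+ 4))// ?lerDr//.
  by rewrite ler_weXn2l// ltW.
have e : expR (- (z ^+ 2 / 2)) * (1 + z ^+ 2 / 4) ^+ 2 <= 1.
  have -> : - (z ^+ 2 / 2) = - (z ^+ 2 / 4) + - (z ^+ 2 / 4) by lra.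
  rewrite expRD -expr2 -exprMn exprn_ile1//.
    by rewrite mulr_ge0 ?expR_ge0// addr_ge0// divr_ge0 ?sqr_ge0.
  by rewrite expRN mulrC ler_pdivrMr ?expR_gt0// mul1r expR_ge1Dx.
rewrite npdfE.
have E0 := expR_ge0 (- (z ^+ 2 / 2)).
have P1 := normal_peak1_le1.
have P0 : 0 <= normal_peak 1 :> R by exact: normal_peak_ge0.
apply: (@le_trans _ _ (`|z| ^+ k * expR (- (z ^+ 2 / 2)))).
  by rewrite ler_wpM2l ?exprn_ge0// ler_piMl.
apply: (@le_trans _ _ ((1 + z ^+ 4) * expR (- (z ^+ 2 / 2)))).
  by rewrite ler_wpM2r.
apply: (@le_trans _ _ (16 * (expR (- (z ^+ 2 / 2)) * (1 + z ^+ 2 / 4) ^+ 2))).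
  rewrite [in leRHS]mulrCA [leLHS]mulrC ler_wpM2l//.
  have := sqr_ge0 z; set y := z ^+ 2; have -> : z ^+ 4 = y ^+ 2 by rewrite /y; ring.
  by move=> y0; nra.
lra.
Qed.

Lemma normal_prob_fin s (A : set R) : measurable A -> normal_prob 0 s A \is a fin_num.
Proof. by move=> mA; rewrite fin_num_measure. Qed.

Lemma ncdfE z : (ncdf z)%:E = normal_prob 0 1 `]-oo, z].
Proof. by rewrite /ncdf fineK// normal_prob_fin. Qed.

Lemma ncdf_ge0 z : 0 <= ncdf z.
Proof. by rewrite -lee_fin ncdfE. Qed.

Lemma ncdf_le1 z : ncdf z <= 1.
Proof. by rewrite -lee_fin ncdfE probability_le1. Qed.

Lemma ncdf_nd : {homo ncdf : x y / x <= y}.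
Proof.
move=> x y xy; rewrite -lee_fin !ncdfE le_measure ?inE//.
by apply: subset_itvl; rewrite bnd_simp.
Qed.

Lemma is_derive_ncdf z : is_derive z 1 ncdf (npdf z).
Proof.
have iz : mu.-integrable `]-oo, z + 1] (EFin \o npdf).
  apply: (integrableS _ _ (@subsetT _ _)) => //.
  exact: integrable_normal_pdf.
have cz : {for z, continuous npdf} by exact/continuous_normal_pdf/oner_neq0.
have zz : z < z + 1 by rewrite ltrDl.
have [|d e] := continuous_FTC1 zz iz _ cz; first by rewrite /= ltNyr.
by apply: DeriveDef => //; rewrite -derive1E.
Qed.

Lemma is_derive_npdf z : is_derive z 1 npdf (- z * npdf z).
Proof.
have -> : npdf = fun z => normal_peak 1 * expR (- (z ^+ 2 / 2)).
  by apply/funext => y; rewrite npdfE.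
apply: is_derive_eq.
rewrite /GRing.scale/=; lra.
Qed.

Lemma is_derive_npdf' z :
  is_derive z 1 (fun z => - z * npdf z) ((z ^+ 2 - 1) * npdf z).
Proof.
have := is_derive_npdf z => ?.
apply: is_derive_eq.
rewrite /GRing.scale/=; lra.
Qed.

Lemma ncdf_lip x y : `|ncdf x - ncdf y| <= 16 * `|x - y|.
Proof.
have := @taylor1 _ ncdf npdf 16 is_derive_ncdf _ y (x - y).
rewrite [y + _]addrC subrK; apply => z.
rewrite ger0_norm ?npdf_ge0//.
by have := @npdf_bound 0 z isT; rewrite expr0 mul1r.
Qed.

Lemma normal_peak_scale s : 0 < s -> normal_peak s = normal_peak 1 / s :> R.
Proof.
move=> s0; rewrite /normal_peak expr1n mul1r -mulrnAr sqrtrM ?sqr_ge0//.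
by rewrite sqrtr_sqr ger0_norm ?ltW// invfM mulrC.
Qed.

Lemma normal_prob_scale s z : 0 < s ->
  normal_prob 0 s `]-oo, z] = (ncdf (z / s))%:E.
Proof.
move=> s0; rewrite ncdfE /normal_prob.
have s'0 : 0 < s^-1 by rewrite invr_gt0.
have dF (x : R) : is_derive x (1 : R) (fun x : R => x / s) s^-1.
  by apply: is_derive_eq; rewrite /GRing.scale/= mulr1 mulr0 add0r.
have F' : (fun x : R => x / s)^`()%classic = cst s^-1.
  by apply/funext => x; rewrite derive1E; apply: derive_val.
rewrite (@increasing_ge0_integration_by_substitutionNy R (fun x => x / s) npdf z).
- apply: eq_integral => x _; congr EFin.
  rewrite !fctE F' /= npdfE normal_pdfE ?gt_eqF// normal_peak_scale//.
  rewrite /normal_fun subr0 [LHS]mulrAC; congr (_ * expR _ * _).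
  by field; rewrite gt_eqF.
- by move=> x y _ _ xy; rewrite ltr_pM2r.
- by rewrite F' => x _; exact: cvg_cst.
- by rewrite F'; exact: is_cvg_cst.
- by rewrite F'; exact: cvg_cst.
- split; first by move=> x _; have ? := dF x; exact: ex_derive.
  apply: cvg_at_left_filter; have ? := dF z.
  by apply: cvgM; [exact: cvg_id|exact: cvg_cst].
- by apply/gt0_cvgMlNy => //; exact: cvg_id.
- apply: continuous_subspaceT; exact/continuous_normal_pdf/oner_neq0.
- by move=> x _; exact: npdf_ge0.
Qed.

Lemma ncdfN z : ncdf (- z) = 1 - ncdf z.
Proof.
apply: EFin_inj; rewrite EFinB !ncdfE.
have -> : normal_prob 0 1 `]-oo, (- z)] = normal_prob 0 1 `]z, +oo[.
  rewrite /normal_prob ge0_integration_by_substitutionNy; last 2 first.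
  - apply: continuous_subspaceT; exact/continuous_normal_pdf/oner_neq0.
  - by move=> x _; exact: npdf_ge0.
  rewrite -integral_itv_obnd_cbnd; last first.
    apply/measurable_funTS/measurable_EFinP.
    apply: measurableT_comp => //; exact: measurable_normal_pdf.
  apply: eq_integral => x _; congr EFin; rewrite /=.
  by have := npdfE x; have := npdfE (- x); rewrite /npdf sqrrN => -> ->.
rewrite -[X in (X - _)%E](@probability_setT _ _ _ (normal_prob 0 1)).
by rewrite -setCitvl probability_setC// ?probability_setT.
Qed.

(** Exponential tilting by exp(- x - z) >= 1 on ]-oo, -z] shifts the mean of the
    Gaussian to - 1 and gives exp(1/2 - z); the polynomial bound is what the
    range r = x^(1/8) of the central regime requires. *)
Lemma ncdf_tail z : 0 < z -> ncdf (- z) <= 8 / z ^+ 2.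
Proof.
move=> z0.
have h : ncdf (- z) <= expR (2^-1 - z).
  rewrite -lee_fin ncdfE /normal_prob.
  apply: (@le_trans _ _ (\int[mu]_(x in `]-oo, (- z)%R])
     ((expR (2^-1 - z))%:E * (normal_pdf (- 1) 1 x)%:E))%E).
    apply: ge0_le_integral => //=.
    - by move=> x _; rewrite lee_fin normal_pdf_ge0.
    - apply/measurable_funTS/measurable_EFinP.
      exact: measurable_normal_pdf.
    - apply/measurable_funTS/emeasurable_funM => //.
      by apply/measurable_EFinP; exact: measurable_normal_pdf.
    - move=> x; rewrite in_itv/= => xz.
      rewrite -EFinM lee_fin !normal_pdfE ?oner_neq0// /normal_fun mulrCA.
      rewrite ler_wpM2l ?normal_peak_ge0// -expRD ler_expR.
      rewrite expr1n opprK subr0; have -> : (1 *+ 2 : R) = 2 by [].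
      by rewrite sqrrD expr1n; lra.
  rewrite ge0_integralZl//; last 2 first.
  - apply/measurable_funTS/measurable_EFinP.
    exact: measurable_normal_pdf.
  - by move=> x _; rewrite lee_fin normal_pdf_ge0.
  rewrite -[leRHS]mule1 lee_wpmul2l//.
  exact: (@probability_le1 _ _ _ (normal_prob (- 1) 1)).
apply: (le_trans h).
rewrite ler_pdivlMr ?exprn_gt0//.
have e1 : expR 2^-1 <= 2 :> R.
  have := expR_ge1Dx (- 2^-1 : R).
  have := expR_gt0 (2^-1 : R); rewrite expRN; set E := expR _ => E0 E1.
  have : E^-1 * E = 1 by rewrite mulVf// gt_eqF.
  nra.
have e2 : expR (- z) * z ^+ 2 <= 4.
  have -> : - z = - (z / 2) + - (z / 2) by lra.
  rewrite expRD expRN; have := expR_ge1Dx (z / 2).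
  have := expR_gt0 (z / 2); set E := expR _ => E0 E1.
  rewrite -expr2 -exprMn -[leRHS]/(4%:R) (_ : 4%:R = 2 ^+ 2); last by ring.
  rewrite lerXn2r ?nnegrE// ?mulr_ge0 ?invr_ge0 ?ltW//.
  rewrite mulrC ltr_pdivrMr//; lra.
rewrite expRD -mulrA.
have := expR_ge0 (- z); have := sqr_ge0 z; have := expR_ge0 (2^-1 : R).
by move: e1 e2; set u := expR 2^-1; set v := expR (- z) * _; nra.
Qed.

Lemma ncdf_taylor a y :
  `|ncdf (a - y) - (ncdf a - y * npdf a - y ^+ 2 / 2 * (a * npdf a))|
    <= 32 * `|y| ^+ 3.
Proof.
have b3 (z : R) : `|(z ^+ 2 - 1) * npdf z| <= 32.
  have := @npdf_bound 2 z isT; have := @npdf_bound 0 z isT.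
  rewrite -[`|z| ^+ 2]normrX (ger0_norm (sqr_ge0 z)) expr0 mul1r => h0 h2.
  have ? := npdf_ge0 z; have ? := sqr_ge0 z.
  by rewrite ler_norml; apply/andP; split; nra.
have := taylor3 is_derive_ncdf is_derive_npdf is_derive_npdf' b3 a (- y).
rewrite normrN; apply: le_trans; rewrite le_eqVlt; apply/orP; left.
by apply/eqP; congr `|_|; lra.
Qed.

(** Changing the variance of the Gaussian: along a exp(-th) the function ncdf has
    first derivative - b npdf b and bounded second derivative (b - b^3) npdf b,
    where b = a exp(-th), and 1 / sqrt (1 + s) = exp(-th) with
    th = ln (1 + s) / 2 = s / 2 + O(s^2). The resulting main term - (s/2) a npdf a is
    (s/2) ncdf'' a, the second-order term of [ncdf_taylor]: this match is the heat
    equation. *)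
Lemma ncdf_sqrt a s : 0 <= s ->
  `|ncdf (a / Num.sqrt (1 + s)) - (ncdf a - s / 2 * (a * npdf a))|
    <= 16 * s ^+ 2.
Proof.
move=> s0; pose b (y : R) := a * expR (- y).
have db (y : R) : is_derive y (1 : R) b (- b y).
  by apply: is_derive_eq; rewrite /b /GRing.scale/=; lra.
have d1 (y : R) : is_derive y (1 : R) (ncdf \o b) (- b y * npdf (b y)).
  have ? := is_derive_ncdf (b y); have ? := db y.
  by apply: is_derive_eq; rewrite /GRing.scale/= mulrC.
have d2 (y : R) : is_derive y (1 : R) (fun y => - b y * npdf (b y))
    ((b y - b y ^+ 3) * npdf (b y)).
  have ? := db y.
  have ? : is_derive y (1 : R) (fun y => npdf (b y)) (b y * npdf (b y) * b y).
    have ? := is_derive_npdf (b y).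
    have := @is_derive1_comp _ npdf b y _ _ _ (db y).
    by move=> /(_ _ (is_derive_npdf _)); rewrite mulrN mulNr mulNr opprK.
  by apply: is_derive_eq; rewrite /GRing.scale/=; ring.
have bd (y : R) : `|(b y - b y ^+ 3) * npdf (b y)| <= 32.
  rewrite mulrBl; apply: (le_trans (ler_normB _ _)); rewrite (normrM (b y)) (normrM (b y ^+ 3)) normrX.
  rewrite (ger0_norm (npdf_ge0 _)).
  have := @npdf_bound 3 (b y) isT; have := @npdf_bound 1 (b y) isT.
  by rewrite expr1; lra.
pose th := ln (1 + s) / 2.
have e2 : expR (th + th) = 1 + s.
  by rewrite -splitr lnK// posrE; lra.
have sq : a / Num.sqrt (1 + s) = b th.
  rewrite -e2 expRD -expr2 sqrtr_sqr ger0_norm ?expR_ge0// /b expRN.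
  by [].
have th1 : th <= s / 2 by have := expR_ge1Dx (th + th); rewrite e2; lra.
have th2 : s / 2 - s ^+ 2 / 2 <= th.
  have := expR_ge1Dx (- (th + th)); rewrite expRN e2.
  have s1 : 0 < 1 + s by lra.
  have -> : (1 + s)^-1 = 1 - s + s ^+ 2 / (1 + s) by field; rewrite gt_eqF.
  have : s ^+ 2 / (1 + s) <= s ^+ 2.
    by rewrite ler_pdivrMr//; have := sqr_ge0 s; nra.
  lra.
have th0 : 0 <= th by rewrite divr_ge0// ln_ge0//; lra.
have := taylor2 d1 d2 bd 0 th; rewrite add0r /= -sq.
have b0 : b 0 = a by rewrite /b oppr0 expR0 mulr1.
rewrite b0 (ger0_norm th0) => t2.
have ag : `|a * npdf a| <= 16.
  by rewrite normrM (ger0_norm (npdf_ge0 _)) -[X in X * _]expr1 npdf_bound.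
rewrite (_ : _ - _ = ncdf (a / Num.sqrt (1 + s)) - ncdf a - th * (- a * npdf a)
   + (s / 2 - th) * (a * npdf a)); last by ring.
apply: (le_trans (ler_normD _ _)).
rewrite [X in _ + X]normrM (ger0_norm (_ : 0 <= s / 2 - th)); last lra.
have : (s / 2 - th) * `|a * npdf a| <= s ^+ 2 / 2 * 16.
  by apply: ler_pM => //; lra.
have : th ^+ 2 <= (s / 2) ^+ 2 by rewrite lerXn2r ?nnegrE//; lra.
rewrite (expr_div_n s) (_ : 2 ^+ 2 = 4 :> R); last by ring.
move: t2; set u := `|_|; set v := `|_|; set t := th ^+ 2; set q := s ^+ 2.
by set w := (s / 2 - th) * v; lra.
Qed.

End normal.

(** * Independence and moment generating functions *)

Section normal_mgf.
Context {R : realType}.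
Notation mu := (@lebesgue_measure R).
Import HBNNSimple.

Lemma measurable_normal_pdfE (m s : R) :
  measurable_fun [set: measurableTypeR R] (fun x => (normal_pdf m s x)%:E).
Proof. by apply/measurable_EFinP; exact: measurable_normal_pdf. Qed.

(** Integration against the normal law is integration of the density against the
    Lebesgue measure: by monotone convergence it is enough to treat simple
    functions, for which it is the definition of the law. *)
Lemma ge0_integral_normal_prob (m s : R) (f : measurableTypeR R -> \bar R) :
  measurable_fun setT f -> (forall x, 0 <= f x)%E ->
  (\int[normal_prob m s]_x f x = \int[mu]_x (f x * (normal_pdf m s x)%:E))%E.
Proof.
move=> mf f0; pose p x := (normal_pdf m s x)%:E.
have p0 x : (0 <= p x)%E by rewrite lee_fin normal_pdf_ge0.
have mp : measurable_fun [set: measurableTypeR R] p by exact: measurable_normal_pdfE.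
pose h := nnsfun_approx measurableT mf.
have hf x : (h n x)%:E @[n --> \oo] --> f x by exact: cvg_nnsfun_approx.
have ndh x : {homo (fun n => (h n x)%:E) : n k / (n <= k)%N >-> (n <= k)%E}.
  by move=> a b ab; rewrite lee_fin; exact/lefP/nd_nnsfun_approx.
transitivity (limn (fun n => \int[normal_prob m s]_x (h n x)%:E))%E.
  rewrite -monotone_convergence//=.
  - by apply: eq_integral => x _; apply/esym/cvg_lim => //; exact: hf.
  - by move=> n; exact/measurable_EFinP.
  - by move=> n x _; rewrite lee_fin.
transitivity (limn (fun n => \int[mu]_x ((h n x)%:E * p x)))%E; last first.
  rewrite -monotone_convergence//=.
  - apply: eq_integral => x _; apply/cvg_lim => //.
    by apply: cvgeZr => //; exact: hf.
  - by move=> n; apply: emeasurable_funM => //; exact/measurable_EFinP.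
  - by move=> n x _; rewrite mule_ge0// lee_fin.
  - by move=> x _ a b ab; rewrite lee_wpmul2r//; exact: ndh.
apply: congr_lim; apply/funext => n.
rewrite integralT_nnsfun sintegralE.
under [RHS]eq_integral.
  move=> x _; rewrite fimfunE -fsumEFin// ge0_mule_fsuml; last first.
    by move=> r; rewrite EFinM nnfun_muleindic_ge0.
  over.
rewrite ge0_integral_fsum//; last 2 first.
- move=> r; apply: emeasurable_funM => //.
  by apply/measurable_EFinP; apply: measurable_funM.
- by move=> r x _; rewrite mule_ge0// EFinM nnfun_muleindic_ge0.
apply: eq_fsbigr => r; rewrite inE => -[t _ hr].
have r0 : 0 <= r by rewrite -hr.
have mr : measurable (h n @^-1` [set r]) by exact: measurable_funPTI.
transitivity (r%:E * \int[mu]_x ((\1_(h n @^-1` [set r]) x)%:E * p x))%E; last first.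
  rewrite -ge0_integralZl//.
  - by apply: eq_integral => x _; rewrite EFinM muleA.
  - apply: emeasurable_funM => //.
    by apply/measurable_EFinP; exact: measurable_indic.
  - by move=> x _; rewrite mule_ge0// lee_fin.
congr (_ * _)%E; rewrite /= /normal_prob [LHS]integral_mkcond.
apply: eq_integral => x _; rewrite patchE indicE.
by case: ifPn => _; rewrite ?mul1e ?mul0e.
Qed.

(** Completing the square turns exp(- q x) times the centered density into
    exp(q^2/2) times the density with mean - q. *)
Lemma normal_prob_mgf (q : R) :
  (\int[normal_prob 0 1]_x (expR (- q * x))%:E = (expR (q ^+ 2 / 2))%:E)%E.
Proof.
rewrite ge0_integral_normal_prob; last 2 first.
- apply/measurable_EFinP; apply: measurableT_comp => //=.
- by move=> x; rewrite lee_fin expR_ge0.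
transitivity (\int[mu]_x ((expR (q ^+ 2 / 2))%:E * (normal_pdf (- q) 1 x)%:E))%E.
  apply: eq_integral => x _; rewrite -!EFinM; congr EFin.
  rewrite !normal_pdfE ?oner_neq0// /normal_fun mulrCA [RHS]mulrCA -!expRD.
  congr (_ * expR _).
  have key (y : R) : - q * y + - (y - 0) ^+ 2 / (1 ^+ 2 *+ 2) =
    q ^+ 2 / 2 + - (y - - q) ^+ 2 / (1 ^+ 2 *+ 2) by rewrite expr1n -[1 *+ 2]/(2 : R); lra.
  exact: key.
rewrite ge0_integralZl//.
- by rewrite integral_normal_pdf mule1.
- exact: measurable_normal_pdfE.
- by move=> x _; rewrite lee_fin normal_pdf_ge0.
Qed.

End normal_mgf.

Section independence.
Context d (T : measurableType d) (R : realType) (P : probability T R).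

(** Fubini-Tonelli for an independent pair. The second variable is allowed to be
    replaced by another one, V', with the same law: in the random walk below V is
    an increment and V' the first step. *)
Lemma ge0_integral_indep (U V V' : T -> R) (f : R -> R -> \bar R) :
  measurable_fun setT U -> measurable_fun setT V -> measurable_fun setT V' ->
  (forall A B, measurable A -> measurable B ->
    P (U @^-1` A `&` V @^-1` B) = (P (U @^-1` A) * P (V' @^-1` B))%E) ->
  (forall x y, 0 <= f x y)%E ->
  measurable_fun [set: R * R] (fun z => f z.1 z.2) ->
  (\int[P]_w f (U w) (V w) = \int[P]_w \int[P]_v f (U w) (V' v))%E.
Proof.
move=> mU mV mV' UV f0 mf.
pose phi w := (U w, V w).
have mphi : measurable_fun setT phi by exact: measurable_fun_pair.
pose MU := [the {mfun T >-> R} of mfun_Sub (mem_set mU)].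
pose MV' := [the {mfun T >-> R} of mfun_Sub (mem_set mV')].
pose Mphi := [the {mfun T >-> (R * R)%type} of mfun_Sub (mem_set mphi)].
pose m1 := distribution P MU.
pose m2 := distribution P MV'.
transitivity (\int[pushforward P Mphi]_z f z.1 z.2)%E.
  by rewrite ge0_integral_pushforward.
rewrite (@eq_measure_integral _ _ _ _ (m1 \x m2)%E); last first.
  move=> A mA _; apply/esym.
  apply: (@product_measure_unique _ _ _ _ _ m1 m2); last by [].
  exact: UV.
rewrite fubini_tonelli1//.
rewrite ge0_integral_distribution//.
- apply: eq_integral => w _ /=; rewrite /fubini_F /=.
  rewrite ge0_integral_distribution//.
  have mp : measurable_fun [set: R] (fun y : R => (U w, y)) by exact: measurable_fun_pair.
  by have := measurableT_comp mf mp; exact.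
- exact: measurable_fun_fubini_tonelli_F.
- by move=> y; rewrite /fubini_F integral_ge0.
Qed.

End independence.

Lemma measurable_mgf_integrand d (T : measurableType d) (R : realType)
    (Y : T -> R) (q : R) : measurable_fun setT Y ->
  measurable_fun setT (fun w => (expR (q * Y w))%:E).
Proof.
move=> mY; apply/measurable_EFinP; apply: measurableT_comp => //.
exact: measurable_funM.
Qed.

Lemma ge0_integral_law d1 d2 (T1 : measurableType d1) (T2 : measurableType d2)
    (R : realType) (m1 : {measure set T1 -> \bar R}) (m2 : {measure set T2 -> \bar R})
    (g : T1 -> T2) (f : T2 -> \bar R) : measurable_fun setT g ->
  (forall A, measurable A -> m1 (g @^-1` A) = m2 A) ->
  measurable_fun setT f -> (forall x, 0 <= f x)%E ->
  (\int[m1]_w f (g w) = \int[m2]_x f x)%E.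
Proof.
move=> mg law mf f0.
pose G := [the {mfun T1 >-> T2} of mfun_Sub (mem_set mg)].
transitivity (\int[pushforward m1 G]_x f x)%E.
  by rewrite ge0_integral_pushforward.
by apply: eq_measure_integral => A mA _; exact: law.
Qed.

Lemma gaussian_rv_mgf d (T : measurableType d) (R : realType)
    (P : probability T R) (V : T -> R) (q : R) : measurable_fun setT V ->
  (forall A : set R, measurable A -> P (V @^-1` A) = normal_prob 0 1 A) ->
  (\int[P]_w (expR (- q * V w))%:E = (expR (q ^+ 2 / 2))%:E)%E.
Proof.
move=> mV VN; rewrite -normal_prob_mgf.
apply: (@ge0_integral_law _ _ T (measurableTypeR R) R P (normal_prob 0 1) V
  (fun x : R => (expR (- q * x))%:E)) => //.
- exact: measurable_mgf_integrand.
Qed.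

Lemma expr_le_expR (R : realType) (k : nat) (e : R) : 0 < e ->
  exists2 C : R, 0 <= C & forall y : R, 0 <= y -> y ^+ k <= C * expR (e * y).
Proof.
elim: k e => [|k IH] e e0.
  exists 1 => // y y0; rewrite expr0 mul1r -[leLHS]expR0 ler_expR.
  by rewrite mulr_ge0// ltW.
have [|C C0 hC] := IH (e / 2); first by rewrite divr_gt0.
exists (C * (2 / e)) => [|y y0]; first by rewrite mulr_ge0// divr_ge0// ltW.
have h : y <= 2 / e * expR (e / 2 * y).
  have := expR_ge1Dx (e / 2 * y) => h1.
  rewrite mulrAC ler_pdivlMr//; lra.
rewrite exprSr {2}(_ : e = e / 2 + e / 2); last by lra.
rewrite [(_ + _) * y]mulrDl expRD mulrACA; apply: ler_pM => //; first exact: exprn_ge0.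
exact: hC.
Qed.

Section mgf.
Context d (T : measurableType d) (R : realType) (P : probability T R).
Variables (Y : T -> R) (delta : R).
Hypothesis mY : measurable_fun setT Y.
Hypothesis finY : forall q : R, `|q| < delta ->
  (\int[P]_w (expR (- q * Y w))%:E < +oo)%E.

Definition power_exp (k : nat) (q : R) (w : T) : R := (- Y w) ^+ k * expR (- q * Y w).

Lemma measurable_power_exp k q : measurable_fun setT (power_exp k q).
Proof.
apply: measurable_funM.
  by apply: measurable_funX; exact: measurable_funN.
by apply: measurableT_comp => //; exact: measurable_funM.
Qed.

(** On |q| <= r < delta the power of Y is absorbed by exp(e |Y|) with
    e = (delta - r)/2, and exp((r + e)|Y|) is at most the sum of the two
    exponentials exp(- s Y) and exp(s Y) with s = r + e < delta. *)
Lemma power_exp_dominated (k : nat) (r : R) : 0 <= r -> r < delta ->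
  exists G : T -> R, [/\ forall w, 0 <= G w, P.-integrable setT (EFin \o G) &
    forall q w, `|q| <= r -> `|power_exp k q w| <= G w].
Proof.
move=> r0 rd; pose e := (delta - r) / 2; have e0 : 0 < e by rewrite /e; lra.
have [C C0 hC] := expr_le_expR k e0.
pose s := r + e.
have intexp (q : R) : `|q| = s ->
    P.-integrable setT (EFin \o (fun w => expR (- q * Y w))).
  move=> qs; apply/integrableP; split.
    apply/measurable_EFinP; apply: measurableT_comp => //.
    exact: measurable_funM.
  under eq_integral => w _ do rewrite /= ger0_norm ?expR_ge0//.
  by apply: finY; rewrite qs /s /e; lra.
have s0 : 0 <= s by rewrite /s; lra.
exists (fun w => C * (expR (- s * Y w) + expR (- (- s) * Y w))); split.
- by move=> w; rewrite mulr_ge0// addr_ge0 ?expR_ge0.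
- apply: (@eq_integrable _ _ _ _ _ measurableT
    (fun w => C%:E * ((expR (- s * Y w))%:E + (expR (- - s * Y w))%:E))%E) => //.
  apply: integrableZl => //; apply: integrableD => //.
    by apply: intexp; rewrite ger0_norm.
  by apply: intexp; rewrite normrN ger0_norm.
- move=> q w qr; rewrite /power_exp normrM normrX normrN (ger0_norm (expR_ge0 _)).
  apply: (@le_trans _ _ (C * expR (e * `|Y w|) * expR (r * `|Y w|))).
    apply: ler_pM => //; rewrite ?exprn_ge0 ?expR_ge0 ?hC//.
    rewrite ler_expR (le_trans (ler_norm _))// normrM normrN.
    by rewrite ler_wpM2r.
  rewrite -mulrA -expRD -mulrDl [e + r]addrC -/s ler_wpM2l//.
  have [y0|y0] := leP 0 (Y w).
    by rewrite opprK (ger0_norm y0) -[leLHS]add0r lerD2r expR_ge0.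
  by rewrite (ltr0_norm y0) mulrN -mulNr -[leLHS]addr0 lerD2l expR_ge0.
Qed.

Lemma integrable_power_exp k q : `|q| < delta ->
  P.-integrable setT (EFin \o power_exp k q).
Proof.
move=> qd; have [G [G0 iG hG]] := power_exp_dominated k (normr_ge0 q) qd.
apply: (le_integrable _ _ _ iG) => //.
  by apply/measurable_EFinP; exact: measurable_power_exp.
by move=> w _ /=; rewrite lee_fin (ger0_norm (G0 w)) hG.
Qed.

(** The k-th derivative at q of the moment generating function of - Y, see
    [is_derive_mgf_deriv]. *)
Definition mgf_deriv k q : R := \int[P]_w power_exp k q w.

Lemma is_derive_power_exp k q w :
  is_derive q (1 : R) (power_exp k ^~ w) (power_exp k.+1 q w).
Proof.
rewrite /power_exp; apply: is_derive_eq.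
by rewrite /GRing.scale/= exprS; ring.
Qed.

Lemma is_derive_mgf_deriv k (q : R) : `|q| < delta -> is_derive q (1 : R) (mgf_deriv k) (mgf_deriv k.+1 q).
Proof.
move=> qd; pose r := (`|q| + delta) / 2.
have q0 := normr_ge0 q.
have r0 : 0 <= r by rewrite /r; lra.
have rd : r < delta by rewrite /r; lra.
have [G [G0 iG hG]] := power_exp_dominated k.+1 r0 rd.
have Iq : `](- r), r[%classic q.
  by rewrite /= in_itv/=; rewrite -ltr_norml /r; lra.
have Ir x : `](- r), r[%classic x -> `|x| <= r.
  by rewrite /= in_itv/= -ltr_norml; exact: ltW.
have intf x : `](- r), r[%classic x -> P.-integrable setT (EFin \o power_exp k x).
  by move=> /Ir xr; apply: integrable_power_exp; exact: le_lt_trans rd.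
have df x w : `](- r), r[%classic x -> setT w -> derivable (power_exp k ^~ w) x 1.
  by move=> _ _; have ? := is_derive_power_exp k x w; exact: ex_derive.
have d1 x w : partial1of2 (power_exp k) x w = power_exp k.+1 x w.
  by rewrite partial1of2E; have ? := is_derive_power_exp k x w; exact: derive_val.
have ub x w : `](- r), r[%classic x -> setT w -> `|partial1of2 (power_exp k) x w| <= G w.
  by move=> /Ir xr _; rewrite d1; exact: hG.
apply: DeriveDef.
  exact: (derivable_under_integral measurableT Iq intf df G0 iG ub).
rewrite -derive1E (differentiation_under_integral measurableT Iq intf df G0 iG ub).
by apply: eq_Rintegral => w _; rewrite d1.
Qed.

Lemma mgf_deriv0E (q r : R) :
  (\int[P]_w (expR (- q * Y w))%:E = r%:E)%E -> r = mgf_deriv 0 q.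
Proof.
move=> h; rewrite /mgf_deriv /Rintegral.
have -> : (\int[P]_w (power_exp 0 q w)%:E = \int[P]_w (expR (- q * Y w))%:E)%E.
  by apply: eq_integral => w _; rewrite /power_exp expr0 mul1r.
by rewrite h.
Qed.

Lemma mgf_deriv_at0 k : mgf_deriv k 0 = \int[P]_w (- Y w) ^+ k.
Proof. by apply: eq_Rintegral => w _; rewrite /power_exp oppr0 mul0r expR0 mulr1. Qed.

End mgf.

(** The exponent phi is recovered from a moment generating function m0 as
    ln m0 - b q + a q^2/2. It is used with a = b = 0 for X_1 itself, and with a = 1
    and b = m for the centered non-Gaussian part, whose generating function lacks
    the factor exp(q^2/2). *)
Section log_mgf.
Context {R : realType}.
Variables (delta a b : R) (m0 m1 m2 phi : R -> R).
Hypothesis delta0 : 0 < delta.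
Hypothesis dm0 : forall q : R, `|q| < delta -> is_derive q (1 : R) m0 (m1 q).
Hypothesis dm1 : forall q : R, `|q| < delta -> is_derive q (1 : R) m1 (m2 q).
Hypothesis m0E : forall q : R, `|q| < delta -> expR (phi q + b * q - a * q ^+ 2 / 2) = m0 q.
Hypothesis phi0 : phi 0 = 0.

Lemma near_ball (q : R) : `|q| < delta -> \forall p \near q, `|p| < delta.
Proof.
rewrite ltr_norml => qd; near=> p; rewrite ltr_norml.
suff : p \in `](- delta), delta[ by rewrite in_itv.
by near: p; apply: near_in_itvoo; rewrite in_itv.
Unshelve. all: by end_near. Qed.

Lemma is_derive_log_mgf (q : R) : `|q| < delta ->
  is_derive q (1 : R) phi (m1 q / m0 q - b + a * q).
Proof.
move=> qd.
have m0q : 0 < m0 q by rewrite -m0E// expR_gt0.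
apply: (@near_eq_is_derive _ _ _ (fun q => ln (m0 q) - b * q + a * q ^+ 2 / 2)).
  near=> p; rewrite -m0E ?expRK; first by ring.
  by near: p; exact: near_ball.
have ? := dm0 qd.
have ? : is_derive q (1 : R) (fun q => ln (m0 q)) (m1 q / m0 q).
  have ? := is_derive1_ln m0q.
  by apply: is_derive_eq; rewrite mulrC.
apply: is_derive_eq; rewrite /GRing.scale/=; lra.
Unshelve. all: by end_near. Qed.

Lemma log_mgf_derivatives : phi^`()%classic 0 = m1 0 - b /\
  phi^`(2)%classic 0 = m2 0 - m1 0 ^+ 2 + a.
Proof.
have d0 : `|0 : R| < delta by rewrite normr0.
have m00 : m0 0 = 1.
  by rewrite -m0E// phi0 expr0n/= !mulr0 mul0r subr0 addr0 expR0.
split.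
  rewrite derive1E; have ? := is_derive_log_mgf d0.
  by rewrite derive_val m00 mulr0 addr0 divr1.
rewrite derive1nS derive1n1 derive1E.
apply: derive_val; apply: (@near_eq_is_derive _ _ _ (fun q => m1 q / m0 q - b + a * q)).
  near=> p; rewrite derive1E.
  have pd : `|p| < delta by near: p; exact: near_ball.
  by have ? := is_derive_log_mgf pd; rewrite derive_val.
have ? := dm0 d0; have ? := dm1 d0.
have ? : is_derive (0 : R) (1 : R) (fun q => (m0 q)^-1) (- m1 0).
  apply: is_derive_eq.
    by apply: is_deriveV; rewrite m00 oner_neq0.
  by rewrite m00 /GRing.scale/= expr1n invr1; lra.
apply: is_derive_eq; rewrite /GRing.scale/= m00 invr1; lra.
Unshelve. all: by end_near. Qed.

(** As phi vanishes at 0 with negative slope, it is negative just to the right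
    of 0. *)
Lemma log_mgf_nonpositive : m1 0 - b < 0 -> exists q, [/\ 0 < q, q < delta & phi q <= 0].
Proof.
move=> m10; have d0 : `|0 : R| < delta by rewrite normr0.
have dp := is_derive_log_mgf d0.
have m00 : m0 0 = 1.
  by rewrite -m0E// phi0 expr0n/= !mulr0 mul0r subr0 addr0 expR0.
have cv : h^-1 *: (phi (h *: 1 + 0) - phi 0) @[h --> 0^'] --> 'D_1 phi 0.
  by have [] := dp.
have D0 : 'D_1 phi 0 < 0 by rewrite derive_val m00 mulr0 addr0 divr1.
have cvr := cvg_dnbhs_at_right cv.
have ltq := cvgr_lt _ cvr _ D0.
near (0 : R)^'+ => q.
have q0 : 0 < q by near: q; exact: nbhs_right_gt.
have qd : q < delta by near: q; exact: nbhs_right_lt.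
exists q; split => //.
have : q^-1 *: (phi (q *: 1 + 0) - phi 0) < 0 by near: q; exact: ltq.
rewrite phi0 subr0 addr0 /GRing.scale/= mulr1 pmulr_rlt0 ?invr_gt0//.
exact: ltW.
Unshelve. all: by end_near. Qed.

End log_mgf.

(** * Lindeberg replacement with a Gaussian component *)

Section bounded.
Context d (T : measurableType d) (R : realType) (P : probability T R).

Lemma integrable_bounded (f : T -> R) (b : R) : measurable_fun setT f ->
  (forall w, `|f w| <= b) -> P.-integrable setT (EFin \o f).
Proof.
move=> mf fb; apply: measurable_bounded_integrable => //.
  by rewrite (le_lt_trans (probability_le1 _ _))// ltry.
exists b; split; first exact: num_real.
by move=> M bM w _; apply: (le_trans (fb w)); exact: ltW.
Qed.

Lemma integrable_prob_cst (r : R) : P.-integrable setT (EFin \o (fun=> r)).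
Proof. exact: (@integrable_bounded (fun=> r) `|r|). Qed.

Lemma Rintegral_prob_cst (r : R) : \int[P]_w r = r.
Proof.
rewrite /Rintegral (integral_cst P measurableT r%:E).
by rewrite [X in fine (_ * X)%E](@probability_setT _ _ _ P) mule1.
Qed.

Lemma Rintegral_close (f g : T -> R) (e : R) :
  P.-integrable setT (EFin \o f) -> P.-integrable setT (EFin \o g) ->
  (forall w, `|f w - g w| <= e) ->
  `|\int[P]_w f w - \int[P]_w g w| <= e.
Proof.
move=> jf jg fg.
have jfg : P.-integrable setT (EFin \o (fun w => f w - g w)).
  apply: (@eq_integrable _ _ _ _ _ measurableT ((EFin \o f) \- (EFin \o g))%E) => //.
  exact: integrableB.
rewrite -RintegralB//.
apply: (le_trans (le_normr_Rintegral _ _)) => //.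
rewrite -[leRHS](Rintegral_prob_cst e); apply: le_Rintegral => //.
  exact: integrable_norm.
exact: integrable_prob_cst.
Qed.

End bounded.

Section lindeberg.
Context d (T : measurableType d) (R : realType) (P : probability T R).
Variable U : T -> R.
Hypothesis mU : measurable_fun setT U.
Hypothesis iU1 : P.-integrable setT (EFin \o U).
Hypothesis iU2 : P.-integrable setT (EFin \o (fun w => U w ^+ 2)).
Hypothesis iU3 : P.-integrable setT (EFin \o (fun w => `|U w| ^+ 3)).
Hypothesis EU : \int[P]_w U w = 0.

Let tau := \int[P]_w (U w ^+ 2).
Let rho := \int[P]_w (`|U w| ^+ 3).
(** 32 bounds the third derivative of the normal distribution function, and 16
    the error in [ncdf_sqrt]. *)
Definition lindeberg_const := 32 * rho + 16 * tau ^+ 2.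

Lemma tau_ge0 : 0 <= tau.
Proof. by apply: Rintegral_ge0 => w _; exact: sqr_ge0. Qed.

Lemma rho_ge0 : 0 <= rho.
Proof. by apply: Rintegral_ge0 => w _; rewrite exprn_ge0. Qed.

Lemma lindeberg_const_ge0 : 0 <= lindeberg_const.
Proof. by rewrite /lindeberg_const addr_ge0// mulr_ge0// ?rho_ge0// sqr_ge0. Qed.

Lemma measurable_ncdf : measurable_fun [set: R] (@ncdf R).
Proof.
by apply: nondecreasing_measurable => //; exact: ncdf_nd.
Qed.

Lemma integrable_ncdf (f : T -> R) : measurable_fun setT f ->
  P.-integrable setT (EFin \o (fun w => ncdf (f w))).
Proof.
move=> mf; apply: (@integrable_bounded _ _ _ _ _ 1).
  by apply: measurableT_comp => //; exact: measurable_ncdf.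
by move=> w; rewrite ger0_norm ?ncdf_ge0// ncdf_le1.
Qed.

(** Both sides agree with the second-order expansion ncdf a - (h^2 tau / 2) a npdf a:
    the left one because U is centered with variance tau, up to the third moment
    of U; the right one by [ncdf_sqrt], up to h^4 <= h^3. *)
Lemma lindeberg_step_normalized (a h : R) : 0 <= h -> h <= 1 ->
  `|\int[P]_w ncdf (a - h * U w) - ncdf (a / Num.sqrt (1 + h ^+ 2 * tau))|
    <= lindeberg_const * h ^+ 3.
Proof.
move=> h0 h1.
pose g := a * npdf a.
(* g is - Phi'' at a, so that p is the second-order Taylor polynomial of Phi at a,
   evaluated at the increment - h U. *)
pose p w := ncdf a - npdf a * (h * U w) - g / 2 * (h ^+ 2 * U w ^+ 2).
have iN : P.-integrable setT (EFin \o (fun w => ncdf (a - h * U w))).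
  by apply: integrable_ncdf; apply: measurable_funB => //; exact: measurable_funM.
have i1 : P.-integrable setT (EFin \o (fun w => (npdf a * h) * U w)).
  have := integrableZl measurableT (npdf a * h) iU1.
  by apply: eq_integrable.
have i2 : P.-integrable setT (EFin \o (fun w => (g / 2 * h ^+ 2) * U w ^+ 2)).
  have := integrableZl measurableT (g / 2 * h ^+ 2) iU2.
  by apply: eq_integrable.
have ic := integrable_prob_cst P.
have ip1 : P.-integrable setT (EFin \o (fun w => ncdf a - (npdf a * h) * U w)).
  have := integrableB measurableT (ic (ncdf a)) i1.
  by apply: eq_integrable.
have ip2 : P.-integrable setT (EFin \o
    (fun w => ncdf a - (npdf a * h) * U w - (g / 2 * h ^+ 2) * U w ^+ 2)).
  have := integrableB measurableT ip1 i2.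
  by apply: eq_integrable.
have pE : p = fun w => ncdf a - (npdf a * h) * U w - (g / 2 * h ^+ 2) * U w ^+ 2.
  by apply/funext => w; rewrite /p; ring.
have ip : P.-integrable setT (EFin \o p) by rewrite pE.
have Ep : \int[P]_w p w = ncdf a - (h ^+ 2 * tau) / 2 * g.
  rewrite pE RintegralB// RintegralB// Rintegral_prob_cst.
  by rewrite RintegralZl// RintegralZl// EU /tau; lra.
have t3 w : `|ncdf (a - h * U w) - p w| <= 32 * h ^+ 3 * `|U w| ^+ 3.
  have pw : ncdf a - h * U w * npdf a - (h * U w) ^+ 2 / 2 * (a * npdf a) = p w.
    by rewrite /p /g; ring.
  have := ncdf_taylor a (h * U w).
  by rewrite pw normrM (ger0_norm h0) [X in 32 * X]exprMn mulrA.
have b1 : `|\int[P]_w ncdf (a - h * U w) - \int[P]_w p w| <= 32 * h ^+ 3 * rho.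
  have iB : P.-integrable setT (EFin \o (fun w => ncdf (a - h * U w) - p w)).
    have := integrableB measurableT iN ip.
    by apply: eq_integrable.
  rewrite -RintegralB//.
  apply: (le_trans (le_normr_Rintegral _ _)) => //.
  rewrite /rho -RintegralZl//; apply: le_Rintegral => //.
    exact: integrable_norm.
  have := integrableZl measurableT (32 * h ^+ 3) iU3.
  by apply: eq_integrable.
have b2 := @ncdf_sqrt R a (h ^+ 2 * tau) (mulr_ge0 (sqr_ge0 h) tau_ge0).
rewrite distrC in b2; rewrite -/g -Ep in b2.
have := ler_distD (\int[P]_w p w) (\int[P]_w ncdf (a - h * U w))
  (ncdf (a / Num.sqrt (1 + h ^+ 2 * tau))).
move=> /le_trans; apply; apply: (le_trans (lerD b1 b2)).
have h43 : h ^+ 4 <= h ^+ 3 by rewrite ler_wiXn2l.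
rewrite exprMn -exprM /lindeberg_const.
have t2 : 0 <= 16 * tau ^+ 2 by rewrite mulr_ge0// sqr_ge0.
have := ler_wpM2l t2 h43; set x := h ^+ _; set y := h ^+ 3; set z := tau ^+ 2.
lra.
Qed.

Lemma lindeberg_step (z v : R) : 1 <= v ->
  `|\int[P]_w ncdf ((z - U w) / Num.sqrt v) - ncdf (z / Num.sqrt (v + tau))|
    <= lindeberg_const / Num.sqrt v ^+ 3.
Proof.
move=> v1; have v0 : 0 < v by lra.
have s0 : 0 < Num.sqrt v by rewrite sqrtr_gt0.
have s1 : 1 <= Num.sqrt v by rewrite -sqrtr1 ler_wsqrtr.
have h1 : (Num.sqrt v)^-1 <= 1 by rewrite invf_le1.
have h0 : 0 <= (Num.sqrt v)^-1 by rewrite invr_ge0 ltW.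
have key : z / Num.sqrt v / Num.sqrt (1 + (Num.sqrt v)^-1 ^+ 2 * tau) =
    z / Num.sqrt (v + tau).
  rewrite -mulrA -invfM -sqrtrM ?ltW// exprVn sqr_sqrtr ?ltW//.
  by rewrite mulrDr mulr1 mulrA divff ?mul1r// gt_eqF.
have := lindeberg_step_normalized (z / Num.sqrt v) h0 h1.
rewrite key (exprVn _ 3).
by under eq_Rintegral => w _ do rewrite [_^-1 * _]mulrC -mulrBl.
Qed.

Variable S : nat -> T -> R.
Hypothesis mS : forall k, measurable_fun setT (S k).
Hypothesis S0 : forall w, S 0%N w = 0.
Hypothesis indS : forall k A B, measurable A -> measurable B ->
  P (S k @^-1` A `&` (S k.+1 \- S k) @^-1` B) =
  (P (S k @^-1` A) * P (U @^-1` B))%E.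

Lemma integrable_shift (f : R -> R) (x : R) : measurable_fun setT f ->
  (forall x, 0 <= f x <= 1) ->
  P.-integrable setT (EFin \o (fun v => f (x + U v))).
Proof.
move=> mf f01; apply: (@integrable_bounded _ _ _ _ _ 1).
  by apply: measurableT_comp => //; exact: measurable_funD.
by move=> v; have /andP[? ?] := f01 (x + U v); rewrite ger0_norm.
Qed.

Lemma measurable_integral_shift (f : R -> R) : measurable_fun setT f ->
  (forall x, 0 <= f x <= 1) ->
  measurable_fun [set: R] (fun x => \int[P]_v f (x + U v)).
Proof.
move=> mf f01; apply/measurable_EFinP.
have mF : measurable_fun [set: R * T] (fun z => (f (z.1 + U z.2))%:E).
  apply/measurable_EFinP; apply: measurableT_comp => //.
  by apply: measurable_funD => //; exact: measurableT_comp.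
have F0 (z : R * T) : (0 <= (f (z.1 + U z.2))%:E)%E.
  by rewrite lee_fin; have /andP[] := f01 (z.1 + U z.2).
have := @measurable_fun_fubini_tonelli_F _ _ _ _ _ P _ mF F0.
apply: eq_measurable_fun => x _.
by rewrite /fubini_F /= /Rintegral fineK//; apply: integrable_fin_num => //; exact: integrable_shift.
Qed.

Lemma integral_shift_le1 (f : R -> R) (x : R) : measurable_fun setT f ->
  (forall x, 0 <= f x <= 1) -> `|\int[P]_v f (x + U v)| <= 1.
Proof.
move=> mf f01; rewrite -[X in `|X|]subr0.
rewrite -(Rintegral_prob_cst P 0).
apply: Rintegral_close; [exact: integrable_shift|exact: integrable_prob_cst|].
by move=> v; have /andP[? ?] := f01 (x + U v); rewrite subr0 ger0_norm.
Qed.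

(** One step of the walk is integrated out first, the past being frozen. *)
Lemma integral_increment (f : R -> R) k : measurable_fun setT f ->
  (forall x, 0 <= f x <= 1) ->
  \int[P]_w f (S k.+1 w) = \int[P]_w \int[P]_v f (S k w + U v).
Proof.
move=> mf f01.
have f0 x : 0 <= f x by have /andP[] := f01 x.
have f1 x : `|f x| <= 1 by rewrite ger0_norm//; have /andP[] := f01 x.
have := @ge0_integral_indep _ T R P (S k) (S k.+1 \- S k) U
  (fun x y => (f (x + y))%:E) (mS k) _ mU (@indS k).
have mB : measurable_fun setT (S k.+1 \- S k) by exact: measurable_funB.
move=> /(_ mB) /(_ _ _)/= e.
have -> : \int[P]_w f (S k.+1 w) = fine (\int[P]_w (f (S k w + (S k.+1 w - S k w)))%:E)%E.
  rewrite /Rintegral; congr fine; apply: eq_integral => w _.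
  by congr (f _)%:E; ring.
rewrite e//; last 2 first.
- by move=> x y; rewrite lee_fin.
- apply/measurable_EFinP; apply: measurableT_comp => //.
  exact: measurable_funD.
congr fine; apply: eq_integral => w _.
rewrite /Rintegral fineK//; apply: integrable_fin_num => //.
apply: (@integrable_bounded _ _ _ _ _ 1) => //.
by apply: measurableT_comp => //; exact: measurable_funD.
Qed.

(** Interpolation between the two terms: after k steps the remaining n - k steps
    are replaced by Gaussian variance (n - k) tau, added to the variance n of the
    smoothing. Each step costs at most lindeberg_const / n^(3/2) because the
    variance never falls below n. *)
Lemma lindeberg (n : nat) (z : R) : (0 < n)%N ->
  `|\int[P]_w ncdf ((z - S n w) / Num.sqrt n%:R)
     - ncdf (z / Num.sqrt (n%:R * (1 + tau)))| <= lindeberg_const / Num.sqrt n%:R.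
Proof.
move=> n0.
have n1 : 1 <= n%:R :> R by rewrite ler1n.
have npos : 0 < n%:R :> R by rewrite ltr0n.
pose v k : R := n%:R + (n - k)%:R * tau.
have vn k : n%:R <= v k by rewrite /v lerDl mulr_ge0// tau_ge0.
pose D k := \int[P]_w ncdf ((z - S k w) / Num.sqrt (v k)).
pose e := lindeberg_const / Num.sqrt n%:R ^+ 3.
have s0 : 0 < Num.sqrt n%:R :> R by rewrite sqrtr_gt0.
have step k : (k < n)%N -> `|D k.+1 - D k| <= e.
  move=> kn.
  have mf : measurable_fun [set: R] (fun s => ncdf ((z - s) / Num.sqrt (v k.+1))).
    apply: measurableT_comp; first exact: measurable_ncdf.
    by apply: measurable_funM => //; exact: measurable_funB.
  have f01 (s : R) : 0 <= ncdf ((z - s) / Num.sqrt (v k.+1)) <= 1.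
    by rewrite ncdf_ge0 ncdf_le1.
  rewrite /D (@integral_increment (fun s => ncdf ((z - s) / Num.sqrt (v k.+1))))//.
  apply: Rintegral_close.
  - apply: (@integrable_bounded _ _ _ _ _ 1).
      exact: measurableT_comp (measurable_integral_shift mf f01) (mS k).
    by move=> w; have := @integral_shift_le1 _ (S k w) mf f01; exact.
  - apply: integrable_ncdf; apply: measurable_funM => //.
    exact: measurable_funB.
  - move=> w.
    under eq_Rintegral do rewrite opprD addrA.
    have -> : v k = v k.+1 + tau.
      rewrite /v -[(n - k)%N]prednK ?subn_gt0// -subnS -natr1; ring.
    apply: (le_trans (lindeberg_step _ (le_trans n1 (vn _)))).
    rewrite /e ler_wpM2l ?lindeberg_const_ge0// lef_pV2 ?posrE ?exprn_gt0//; last first.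
      by rewrite sqrtr_gt0 (lt_le_trans npos).
    by rewrite lerXn2r ?nnegrE ?sqrtr_ge0// ler_wsqrtr.
(* The n errors e = lindeberg_const / n^(3/2) add up to lindeberg_const / sqrt n. *)
have tele k : (k <= n)%N -> `|D k - D 0%N| <= k%:R * e.
  elim: k => [|k IH] kn; first by rewrite subrr normr0 mul0r.
  rewrite (le_trans (ler_distD (D k) _ _))// -natr1 mulrDl mul1r addrC.
  apply: lerD; [exact/IH/ltnW|exact: step].
have := tele n (leqnn _); rewrite /D /v subnn mul0r addr0 subn0.
have -> : \int[P]_w ncdf ((z - S 0%N w) / Num.sqrt (n%:R + n%:R * tau)) =
    ncdf (z / Num.sqrt (n%:R * (1 + tau))).
  under eq_Rintegral do rewrite S0 subr0.
  by rewrite Rintegral_prob_cst mulrDr mulr1.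
move=> /le_trans; apply; rewrite /e.
have ns : n%:R = Num.sqrt n%:R ^+ 2 :> R by rewrite sqr_sqrtr// ltW.
rewrite {1}ns le_eqVlt; apply/orP; left; apply/eqP; field.
by rewrite gt_eqF.
Qed.

End lindeberg.

Section gaussian_sum.
Context d (T : measurableType d) (R : realType) (P : probability T R).

(** An independent Gaussian summand smooths the distribution function: condition
    on Z. *)
Lemma gaussian_sum_cdf (Z V : T -> R) (s y : R) : 0 < s ->
  measurable_fun setT Z -> measurable_fun setT V ->
  (forall A : set R, measurable A -> P (V @^-1` A) = normal_prob 0 s A) ->
  (forall A B : set R, measurable A -> measurable B ->
    P (Z @^-1` A `&` V @^-1` B) = (P (Z @^-1` A) * P (V @^-1` B))%E) ->
  fine (P [set w | Z w + V w <= y]) = \int[P]_w ncdf ((y - Z w) / s).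
Proof.
move=> s0 mZ mV VN ZV.
have mi : measurable_fun [set: R] (fun x => (\1_(`]-oo, y]) x)%:E : \bar R).
  by apply/measurable_EFinP; exact: measurable_indic.
have := @ge0_integral_indep _ T R P Z V V (fun a b => (\1_(`]-oo, y]) (a + b))%:E)
  mZ mV mV ZV.
move=> /(_ _ _)/= e.
have mZV : measurable_fun setT (Z \+ V) by exact: measurable_funD.
rewrite -[[set w | _]]/((Z \+ V) @^-1` `]-oo, y]) -[X in P X]setIT.
rewrite -integral_indic//; last first.
  by rewrite -[X in measurable X]setTI; exact: mZV.
rewrite e//; last first.
  by apply: (measurableT_comp mi); exact: measurable_funD.
congr fine; apply: eq_integral => w _.
have -> : (\int[P]_v (\1_(`]-oo, y]) (Z w + V v))%:E)%E = P (V @^-1` `]-oo, y - Z w]).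
  rewrite -[X in P X]setIT -integral_indic//; last first.
    by rewrite -[X in measurable X]setTI; exact: mV.
  apply: eq_integral => v _; congr EFin; rewrite !indicE; congr (_%:R); congr nat_of_bool.
  by apply/idP/idP; rewrite !inE/= !in_itv/= lerBrDl.
by rewrite VN// normal_prob_scale.
Qed.

End gaussian_sum.

(** * First passage and the position at integer times *)

Lemma dyadic_between (R : realType) (a b : R) : 0 <= a -> a < b ->
  exists k j : nat, a < j%:R / 2 ^+ k < b.
Proof.
move=> a0 ab; have ba : 0 < b - a by rewrite subr_gt0.
pose k := (Num.truncn (b - a)^-1).+1.
have k0 : 0 < 2 ^+ k :> R by rewrite exprn_gt0.
have hk : (b - a)^-1 < 2 ^+ k.
  have iba : 0 <= (b - a)^-1 by rewrite invr_ge0 ltW.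
  have /andP[_ h] := truncn_itv iba; apply: (lt_trans h).
  by rewrite -/k -natrX ltr_nat ltn_expl.
have hk1 : 1 < (b - a) * 2 ^+ k by rewrite -ltr_pdivrMl ?mulr1.
have ak : 0 <= a * 2 ^+ k by rewrite mulr_ge0// ltW.
have /andP[j1 j2] := truncn_itv ak.
exists k, (Num.truncn (a * 2 ^+ k)).+1.
rewrite ltr_pdivlMr// j2/= ltr_pdivrMr// -natr1; lra.
Qed.

Section hitting.
Context d (T : measurableType d) (R : realType) (P : probability T R).
Variable X : R -> T -> R.
Hypothesis LX : levy_process P X.

Lemma levy_measurable t : 0 <= t -> measurable_fun setT (X t).
Proof. by case: LX => + _ _ _ _; apply. Qed.

Lemma measurable_above t x : 0 <= t -> measurable [set w | x < X t w].
Proof.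
move=> t0; have := levy_measurable t0 measurableT (measurable_itv `]x, +oo[).
rewrite setTI; congr measurable; apply/seteqP.
by split => w /=; rewrite in_itv/= andbT.
Qed.

Lemma measurable_below t x : 0 <= t -> measurable [set w | X t w <= x].
Proof.
move=> t0; have := levy_measurable t0 measurableT (measurable_itv `]-oo, x]).
by rewrite setTI.
Qed.

(** The event that the level x is exceeded before time e, that is T_x < e. *)
Definition passed (x e : R) := [set w | exists2 t, 0 <= t < e & x < X t w].

Definition grid (k j : nat) : R := j%:R / 2 ^+ k.

Lemma grid_ge0 k j : 0 <= grid k j.
Proof. by rewrite /grid divr_ge0// exprn_ge0. Qed.

(** By right continuity the level stays exceeded during some time after it is
    first exceeded, hence at a dyadic time. This makes passage events measurable
    and reachable along finite grids. *)
Lemma passed_grid x e w : passed x e w ->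
  exists k j, grid k j < e /\ x < X (grid k j) w.
Proof.
move=> [t /andP[t0 te] xt].
have [_ _ cad _ _] := LX; have [rc _] := cad w.
have [r /= r0 hr] := cvgr_gt _ (rc t t0) _ xt.
have [|k [j /andP[h1 h2]]] := @dyadic_between R t (Num.min e (t + r)) t0.
  by rewrite lt_min te ltrDl.
exists k, j; move: h2; rewrite lt_min => /andP[h2 h3]; split => //.
by apply: hr => //=; rewrite ltr_norml; apply/andP; rewrite /grid; lra.
Qed.

Lemma passedE x e :
  passed x e = \bigcup_k \bigcup_j (if grid k j < e then [set w | x < X (grid k j) w] else set0).
Proof.
apply/seteqP; split => w.
  by move=> /passed_grid[k [j [h1 h2]]]; exists k => //; exists j => //; rewrite h1.
move=> [k _ [j _]]; case: ifPn => // h1 h2.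
by exists (grid k j) => //; rewrite grid_ge0.
Qed.

Lemma measurable_passed x e : measurable (passed x e).
Proof.
rewrite passedE; apply: bigcupT_measurable => k; apply: bigcupT_measurable => j.
by case: ifP => // _; apply: measurable_above; exact: grid_ge0.
Qed.

Lemma hitting_time_lt x w (e : \bar R) :
  (hitting_time X x w < e)%E <->
  exists t : R, [/\ 0 <= t, x < X t w & (t%:E < e)%E].
Proof.
split => [/ereal_inf_lt[_ [t /= [t0 xt] <-] te]|[t [t0 xt te]]].
  by exists t.
apply: le_lt_trans te; apply: ereal_inf_lbound.
by exists t.
Qed.

Lemma hitting_time_le x (s : R) :
  [set w | (hitting_time X x w <= s%:E)%E] = \bigcap_i passed x (s + i.+1%:R^-1).
Proof.
apply/seteqP; split => w /=.
  move=> h i _.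
  have /hitting_time_lt[t [t0 xt te]] : (hitting_time X x w < (s + i.+1%:R^-1)%:E)%E.
    by apply: le_lt_trans h _; rewrite lte_fin ltrDl invr_gt0.
  by exists t => //; rewrite t0 -lte_fin.
move=> h; rewrite leNgt; apply/negP => lt.
have [r sr rT] : exists2 r : R, s < r & (r%:E <= hitting_time X x w)%E.
  case: (hitting_time X x w) lt => [r| |].
  - by rewrite lte_fin => sr; exists r.
  - by move=> _; exists (s + 1); [rewrite ltrDl|rewrite leey].
  - by rewrite ltNge leNye.
have rs : 0 < r - s by rewrite subr_gt0.
have irs : 0 <= (r - s)^-1 by rewrite invr_ge0 ltW.
have := truncn_itv irs; set i := Num.truncn _ => /andP[_ ri].
have [t /andP[t0 te] xt] := h i I.
move: rT; apply/negP; rewrite -ltNge; apply/hitting_time_lt; exists t; split => //.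
rewrite lte_fin (lt_le_trans te)//.
have : i.+1%:R^-1 <= r - s.
  by rewrite -[leRHS]invrK lef_pV2 ?posrE ?invr_gt0// ltW.
by rewrite lerBrDl.
Qed.

Lemma measurable_hitting x s : measurable [set w | (hitting_time X x w <= s%:E)%E].
Proof.
by rewrite hitting_time_le; apply: bigcapT_measurable => i; exact: measurable_passed.
Qed.

Lemma hitting_lower x (t s : R) : 0 <= t -> t <= s ->
  (P [set w | (x < X t w)%R] <= P [set w | (hitting_time X x w <= s%:E)%E])%E.
Proof.
move=> t0 ts; apply: le_measure; rewrite ?inE.
- exact: measurable_above.
- exact: measurable_hitting.
- move=> w /= xt; apply: (@le_trans _ _ t%:E); last by rewrite lee_fin.
  by apply: ereal_inf_lbound; exists t.
Qed.

Section upper.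
Variables (q phiq : R).
Hypothesis q0 : 0 < q.
Hypothesis phiq0 : phiq <= 0.
Hypothesis expX : forall t, 0 <= t ->
  ('E_P[fun w => expR (- q * X t w)%R])%E = (expR (t * phiq))%:E.

(** Markov's inequality for exp(- q X_t), whose mean exp(t phi q) is at most 1
    uniformly in t. *)
Lemma chernoff_below t a : 0 <= t ->
  (P [set w | (X t w <= - a)%R] <= (expR (- (q * a)))%:E)%E.
Proof.
move=> t0; have mB := measurable_below (- a) t0.
have mX := levy_measurable t0.
have h : ((expR (q * a))%:E * P [set w | (X t w <= - a)%R] <= 1)%E.
  rewrite -[X in P X]setIT -integral_indic// -ge0_integralZl//; last first.
    by apply/measurable_EFinP; exact: measurable_indic.
  apply: (@le_trans _ _ (\int[P]_w (expR (- q * X t w))%:E)%E).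
    apply: ge0_le_integral => //=.
    - apply: emeasurable_funM => //.
      by apply/measurable_EFinP; exact: measurable_indic.
    - apply/measurable_EFinP; apply: measurableT_comp => //.
      exact: measurable_funM.
    - move=> w _; rewrite -EFinM lee_fin indicE.
      case: (boolP (w \in _)) => [|_]; last by rewrite mulr0 expR_ge0.
      by rewrite inE/= => Xa; rewrite mulr1 ler_expR mulNr -mulrN ler_pM2l// lerNr.
  have := expX t0; rewrite unlock => ->.
  by rewrite lee_fin -expR0 ler_expR mulr_ge0_le0.
rewrite expRN -[leRHS]mul1e -lee_pdivrMr ?invr_gt0 ?expR_gt0//.
by rewrite invrK muleC.
Qed.

Lemma increment_below s t a : 0 <= s -> s <= t ->
  (P [set w | (X t w - X s w <= - a)%R] <= (expR (- (q * a)))%:E)%E.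
Proof.
move=> s0 st; have [_ _ _ _ stat] := LX.
have ts : 0 <= t - s by rewrite subr_ge0.
have := stat s (t - s) `]-oo, (- a)]%classic s0 ts (measurable_itv _).
rewrite [s + _]addrC subrK => e.
have -> : [set w | X t w - X s w <= - a] = (X t \- X s) @^-1` `]-oo, (- a)]%classic.
  by apply/seteqP; split => w /=; rewrite in_itv.
rewrite e; have -> : X (t - s) @^-1` `]-oo, (- a)]%classic = [set w | X (t - s) w <= - a].
  by apply/seteqP; split => w /=; rewrite in_itv.
exact: chernoff_below.
Qed.

(** Decompose according to the first grid time j h at which the level x is
    exceeded. On the j-th piece, ending at or below x - a forces the increment after
    j h to be at most - a; this increment is independent of the piece, which is
    determined by the path up to time j h. *)
Lemma grid_passage (h x a : R) (M : nat) (N : R) : 0 <= h -> M%:R * h <= N ->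
  (P (\bigcup_(j < M) [set w | (x < X (j%:R * h) w)%R] `&` [set w | (X N w <= x - a)%R])
    <= (expR (- (q * a)))%:E)%E.
Proof.
move=> h0 MN.
have jh0 j : 0 <= j%:R * h by rewrite mulr_ge0.
have N0 : 0 <= N by exact: le_trans MN.
have [_ _ _ indep _] := LX.
pose F j := [set w | x < X (j%:R * h) w].
have mF j : measurable (F j) by exact: measurable_above.
have mD := seqDU_measurable mF.
pose C j := [set w | X N w - X (j%:R * h) w <= - a].
have mC j : measurable (C j).
  have mNj : measurable_fun setT (X N \- X (j%:R * h)).
    by apply: measurable_funB; exact: levy_measurable.
  have := mNj measurableT `]-oo, (- a)]%classic (measurable_itv _).
  by rewrite setTI.
rewrite (bigcup_mkord M F) bigsetU_seqDU.
have tD := trivIset_seqDU F.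
have sub : \big[setU/set0]_(k < M) seqDU F k `&` [set w | X N w <= x - a] `<=`
    \big[setU/set0]_(k < M) (seqDU F k `&` C k).
  rewrite -(bigcup_mkord M (seqDU F)) -(bigcup_mkord M (fun k => seqDU F k `&` C k)).
  move=> w [[j jM Dj] /= XN]; exists j => //; split => //.
  have xj : x < X (j%:R * h) w := subset_seqDU Dj.
  by rewrite /C/=; lra.
apply: (le_trans (le_measure P _ _ sub)); rewrite ?inE.
- apply: measurableI; last exact: measurable_below.
  exact: bigsetU_measurable.
- by apply: bigsetU_measurable => j _; exact: measurableI.
rewrite (@measure_bigsetU _ _ _ P (fun k => seqDU F k `&` C k))//; last 2 first.
- by move=> i; exact: measurableI.
- by apply: trivIset_setIr.
have split j : (j < M)%N -> P (seqDU F j `&` C j) = (P (seqDU F j) * P (C j))%E.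
  move=> jM.
  have jN : j%:R * h <= N.
    by apply: le_trans MN; rewrite ler_wpM2r// ler_nat ltnW.
  have sD : process_sigma X `[0, j%:R * h] (seqDU F j).
    pose G := g_sigma_algebraType [set E | exists t (A : set R),
      [/\ `[0, j%:R * h]%classic t, measurable A & E = X t @^-1` A]].
    have mG (i : nat) : (i <= j)%N -> @measurable _ G (F i).
      move=> ij; apply: sub_sigma_algebra; exists (i%:R * h), `]x, +oo[%classic.
      split; [|exact: measurable_itv|].
        by rewrite /= in_itv/= jh0/= ler_wpM2r// ler_nat.
      by apply/seteqP; split => w /=; rewrite in_itv/= andbT.
    suff : @measurable _ G (seqDU F j) by [].
    apply: measurableD; first exact: mG.
    apply: bigsetU_measurable => i _; apply: mG.
    exact: ltnW.
  have := indep _ _ _ `]-oo, (- a)]%classic (jh0 j) jN sD (measurable_itv _).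
  have -> // : (X N \- X (j%:R * h)) @^-1` `]-oo, - a] = C j.
  by apply/seteqP; split => w /=; rewrite in_itv.
apply: (@le_trans _ _ (\sum_(j < M) P (seqDU F j) * (expR (- (q * a)))%:E)%E).
  apply: lee_sum => j _; have jM := ltn_ord j; rewrite /= [leLHS](split j jM).
  apply: lee_wpmul2l => //; apply: increment_below => //.
  by apply: le_trans MN; rewrite ler_wpM2r// ler_nat ltnW.
rewrite -ge0_sume_distrl// -(@measure_bigsetU _ _ _ P (seqDU F))//.
rewrite -[leRHS]mul1e; apply: lee_wpmul2r; first by rewrite lee_fin expR_ge0.
by apply: probability_le1; exact: bigsetU_measurable.
Qed.

(** The dyadic grids are nested, so the grid events increase to the passage event
    and the uniform bound of [grid_passage] passes to the limit. *)
Lemma passage (x a : R) (N : nat) :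
  (P (passed x N%:R `&` [set w | (X N%:R w <= x - a)%R])
    <= (expR (- (q * a)))%:E)%E.
Proof.
pose h k : R := (2 ^+ k)^-1.
have h0 k : 0 <= h k by rewrite invr_ge0 exprn_ge0.
pose E k := \bigcup_(j < (N * 2 ^ k)%N) [set w | x < X (j%:R * h k) w]
  `&` [set w | X N%:R w <= x - a].
have Nh k : (N * 2 ^ k)%:R * h k <= N%:R.
  by rewrite natrM natrX mulfK// expf_neq0.
have mB : measurable [set w | X N%:R w <= x - a] by exact: measurable_below.
have mE k : measurable (E k).
  apply: measurableI => //; apply: bigcup_measurable => j _.
  by apply: measurable_above; rewrite mulr_ge0.
have EE : passed x N%:R `&` [set w | X N%:R w <= x - a] = \bigcup_k E k.
  apply/seteqP; split => w.
    move=> [/passed_grid[k [j [jN xj]]] XN]; exists k => //; split => //.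
    exists j => //=; move: jN.
    by rewrite /grid ltr_pdivrMr ?exprn_gt0// -natrX -natrM ltr_nat.
  move=> [k _ [[j /= jN xj] XN]]; split => //; exists (j%:R * h k) => //.
  rewrite mulr_ge0//= ltr_pdivrMr ?exprn_gt0//.
  by rewrite -natrX -natrM ltr_nat.
have nd : {homo E : n m / (n <= m)%N >-> (n <= m)%O}.
  apply/nondecreasing_seqP => k; apply/subsetPset; apply: setSI.
  move=> w [j /= jN xj]; exists (j * 2)%N.
    by rewrite /= expnSr mulnA ltn_mul2r.
  rewrite /= natrM /h exprSr invfM mulrACA divff// mulr1.
  exact: xj.
have cv := @nondecreasing_cvg_mu _ _ _ P _ mE _ nd.
rewrite EE -(cvg_lim _ (cv _))//; last exact: bigcupT_measurable.
apply: lime_le.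
  by apply/cvg_ex; eexists; apply: cv; exact: bigcupT_measurable.
by apply: nearW => k; apply: grid_passage.
Qed.

Lemma hitting_upper (x a s : R) (N : nat) : s < N%:R ->
  (P [set w | (hitting_time X x w <= s%:E)%E] <=
   P [set w | (x - a < X N%:R w)%R] + (expR (- (q * a)))%:E)%E.
Proof.
move=> sN.
have mA : measurable [set w | x - a < X N%:R w] by exact: measurable_above.
have mB : measurable (passed x N%:R `&` [set w | (X N%:R w <= x - a)%R]).
  by apply: measurableI; [exact: measurable_passed|exact: measurable_below].
(* If T_x <= s < N, either X_N > x - a, or x has been passed before N and the path
   has come back down to x - a. *)
apply: (@le_trans _ _ (P ([set w | x - a < X N%:R w] `|`
   (passed x N%:R `&` [set w | (X N%:R w <= x - a)%R])))).
  apply: le_measure; rewrite ?inE//.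
  - exact: measurable_hitting.
  - exact: measurableU.
  - move=> w /= hs; have [|Xa] := ltP (x - a) (X N%:R w); [by left|right; split => //].
    have /hitting_time_lt[t [t0 xt tN]] : (hitting_time X x w < N%:R%:E)%E.
      by apply: le_lt_trans hs _; rewrite lte_fin.
    by exists t => //; rewrite t0 -lte_fin.
apply: (le_trans (measureU2 _ _ _)) => //.
by apply: leeD => //; exact: passage.
Qed.

End upper.

End hitting.

(** * From positions to first-passage times *)

(** An abstract inversion: p n plays the role of the distribution function of
    X_n and H x that of T_x. The first hypothesis is a Berry-Esseen bound, the next
    two are the comparison of first passage with positions. *)
Section renewal_inversion.
Context {R : realType}.
Variables (m sigma C q : R) (p : nat -> R -> R) (H : R -> R -> R).
Hypotheses (m0 : 0 < m) (sigma0 : 0 < sigma) (C0 : 0 <= C) (q0 : 0 < q).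
Hypothesis clt : forall n y, (0 < n)%N ->
  `|p n y - ncdf ((y - n%:R * m) / (sigma * Num.sqrt n%:R))| <= C / Num.sqrt n%:R.
Hypothesis lower : forall n x s, n%:R <= s -> 1 - p n x <= H x s.
Hypothesis upper : forall n x s a, s < n%:R ->
  H x s <= 1 - p n (x - a) + expR (- (q * a)).
Hypothesis H01 : forall x s, 0 <= H x s <= 1.
Hypothesis Hnd : forall x s s', s <= s' -> H x s <= H x s'.

Let u := Num.sqrt m.
Let zeta := Num.sqrt (sigma ^+ 2 / m ^+ 3).
Let Cz := (4 * u ^+ 5 + 2 * u * (u ^+ 2 + 1)) / sigma.

Let u0 : 0 < u. Proof. by rewrite sqrtr_gt0. Qed.
Let u2 : u ^+ 2 = m. Proof. by rewrite sqr_sqrtr// ltW. Qed.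

Lemma zetaE : zeta = sigma / u ^+ 3.
Proof.
rewrite /zeta -u2 -exprM mulnC exprM -expr_div_n sqrtr_sqr ger0_norm//.
by rewrite divr_ge0// ?exprn_ge0// ltW.
Qed.

Lemma zeta0 : 0 < zeta.
Proof. by rewrite zetaE divr_gt0// exprn_gt0. Qed.

(** With k = r^8/m + t r^4 + del and |del| <= 1, one has
    k m - r^8 = m t r^4 + m del. Writing y = sqrt k and u = sqrt m, the difference of the
    two normalizations is (1/sigma) (u^2 t (r^4/y - u) + (u^2 del + b)/y), and
    (r^4 - u y)(r^4 + u y) = r^8 - m k is itself O(r^5), while 1/y <= 2 u / r^4.
    The condition 1 + 4 m <= r ensures r^8 <= 2 k m. *)
Lemma normalized_gap_close (k : nat) (r t b : R) : 1 + 4 * m <= r -> `|t| <= r ->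
  `|k%:R - (r ^+ 8 / m + t * r ^+ 4)| <= 1 -> 0 <= b -> b <= r ^+ 2 ->
  [/\ (0 < k)%N, (Num.sqrt k%:R)^-1 <= 2 * u / r ^+ 2 &
    `|(k%:R * m - r ^+ 8 + b) / (sigma * Num.sqrt k%:R) - t / zeta| <= Cz / r ^+ 2].
Proof.
move=> r0 tr kd b0 br; have mgt0 := m0.
have r1 : 1 <= r by lra.
have rgt0 : 0 < r by lra.
have mn0 : m != 0 by rewrite gt_eqF.
pose del := k%:R - (r ^+ 8 / m + t * r ^+ 4).
have kE : k%:R * m = r ^+ 8 + m * t * r ^+ 4 + m * del by rewrite /del; field.
have r30 : 1 <= r ^+ 2 by rewrite exprn_ege1.
have r41 : 1 <= r ^+ 4 by rewrite exprn_ege1.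
have kbig : r ^+ 8 <= 2 * (k%:R * m).
  have [t1 t2] : - r <= t /\ t <= r by move: tr; rewrite ler_norml => /andP.
  have [d1 d2] : - 1 <= del /\ del <= 1 by move: kd; rewrite ler_norml => /andP.
  rewrite kE.
  have a1 : - (r * r ^+ 4) <= t * r ^+ 4 by rewrite -mulNr ler_wpM2r// (le_trans _ r41).
  have a2 : 1 <= r * r ^+ 4 by rewrite -[leLHS]mulr1 ler_pM.
  have a3 : m * (- (2 * (r * r ^+ 4))) <= m * (t * r ^+ 4 + del).
    by rewrite ler_pM2l//; lra.
  have a4 : (4 * m) * (r * r ^+ 4) <= r ^+ 3 * (r * r ^+ 4).
    apply: ler_wpM2r; first by lra.
    have : r * 1 <= r * r ^+ 2 by rewrite ler_pM2l.
    by rewrite -exprS; lra.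
  have e8 : r ^+ 8 = r ^+ 3 * (r * r ^+ 4) by ring.
  by rewrite e8 in a4 *; lra.
have k0 : (0 < k)%N.
  rewrite lt0n; apply/eqP => kz; move: kbig; rewrite kz mul0r mulr0.
  by apply/negP; rewrite -ltNge exprn_gt0.
pose y := Num.sqrt k%:R : R.
have y0 : 0 < y by rewrite sqrtr_gt0 ltr0n.
have y2 : y ^+ 2 = k%:R by rewrite sqr_sqrtr.
have yinv : y^-1 <= 2 * u / r ^+ 4.
  rewrite ler_pdivlMr ?exprn_gt0// mulrC ler_pdivrMr//.
  have uy0 : 0 <= 2 * u * y by rewrite !mulr_ge0// ltW.
  have r40 : 0 <= r ^+ 4 by lra.
  rewrite -(@ler_pXn2r _ 2) ?nnegrE//.
  have -> : (2 * u * y) ^+ 2 = 4 * u ^+ 2 * y ^+ 2 by ring.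
  rewrite y2 u2 -exprM.
  have : 0 <= k%:R * m by rewrite mulr_ge0// ltW.
  by move: kbig; rewrite -[r ^+ (4 * 2)]/(r ^+ 8); lra.
have yinv0 : 0 <= y^-1 by rewrite invr_ge0 ltW.
split=> //.
  apply: (le_trans yinv); rewrite ler_pM2l ?mulr_gt0//.
  by rewrite lef_pV2 ?posrE ?exprn_gt0// ler_weXn2l.
rewrite -/y zetaE.
have -> : (k%:R * m - r ^+ 8 + b) / (sigma * y) - t / (sigma / u ^+ 3) =
  ((u ^+ 2 * t) * (- (u ^+ 2 * t * r ^+ 4 + u ^+ 2 * del) / (y * (r ^+ 4 + u * y)))
    + (u ^+ 2 * del + b) / y) / sigma.
  have -> : k%:R * m - r ^+ 8 + b = m * t * r ^+ 4 + m * del + b by rewrite kE; ring.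
  have e : - (u ^+ 2 * t * r ^+ 4 + u ^+ 2 * del) = r ^+ 8 - u ^+ 2 * y ^+ 2.
    by rewrite y2 u2 [m * k%:R]mulrC kE; ring.
  have s1 : r ^+ 4 + u * y != 0 by rewrite gt_eqF// addr_gt0 ?mulr_gt0// exprn_gt0.
  rewrite e -u2; field.
  by rewrite s1 !gt_eqF.
have P0 : 0 < r ^+ 4 + u * y by rewrite addr_gt0 ?mulr_gt0// exprn_gt0.
have b1 : `|- (u ^+ 2 * t * r ^+ 4 + u ^+ 2 * del) / (y * (r ^+ 4 + u * y))|
    <= 2 * u ^+ 2 * r * (2 * u / r ^+ 4).
  set N := - _; have -> : N / (y * (r ^+ 4 + u * y)) = N / (r ^+ 4 + u * y) * y^-1.
    by rewrite invfM; ring.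
  rewrite (normrM _ y^-1) (ger0_norm yinv0) /N.
  apply: ler_pM => //.
  rewrite normrM normrN normfV (gtr0_norm P0) ler_pdivrMr//.
  apply: (@le_trans _ _ (2 * u ^+ 2 * r * r ^+ 4)); last first.
    by rewrite ler_wpM2l// ?lerDl ?mulr_ge0 ?exprn_ge0 ?ltW.
  apply: (le_trans (ler_normD _ _)); rewrite (normrM (u ^+ 2 * t)).
  rewrite (normrM (u ^+ 2) t) (normrM (u ^+ 2) del) (ger0_norm (sqr_ge0 u)).
  rewrite (ger0_norm (exprn_ge0 4 (ltW rgt0))).
  have uu : 0 <= u ^+ 2 by exact: sqr_ge0.
  have c1 : u ^+ 2 * `|t| * r ^+ 4 <= u ^+ 2 * r * r ^+ 4.
    by rewrite ler_wpM2r ?(le_trans _ r41)// ler_wpM2l.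
  have c2 : u ^+ 2 * `|del| <= u ^+ 2 * (r * r ^+ 4).
    rewrite ler_wpM2l// (le_trans kd)// -[leLHS]mulr1.
    by rewrite ler_pM.
  by lra.
have b2 : `|(u ^+ 2 * del + b) / y| <= (u ^+ 2 + 1) * r ^+ 2 * (2 * u / r ^+ 4).
  rewrite (normrM _ y^-1) (ger0_norm yinv0); apply: ler_pM => //.
  apply: (le_trans (ler_normD _ _)); rewrite (normrM (u ^+ 2)) (ger0_norm (sqr_ge0 u)) (ger0_norm b0).
  have : u ^+ 2 * `|del| <= u ^+ 2 * r ^+ 2 by rewrite ler_wpM2l ?sqr_ge0// (le_trans kd).
  by lra.
rewrite (normrM _ sigma^-1) normfV (gtr0_norm sigma0) /Cz [leRHS]mulrAC ler_pM2r ?invr_gt0//.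
apply: (le_trans (ler_normD _ _)).
have b3 : `|u ^+ 2 * t * (- (u ^+ 2 * t * r ^+ 4 + u ^+ 2 * del) / (y * (r ^+ 4 + u * y)))|
    <= u ^+ 2 * r * (2 * u ^+ 2 * r * (2 * u / r ^+ 4)).
  rewrite (normrM (u ^+ 2 * t)); apply: ler_pM => //.
  by rewrite (normrM (u ^+ 2)) (ger0_norm (sqr_ge0 u)) ler_wpM2l ?sqr_ge0.
apply: (le_trans (lerD b3 b2)); rewrite le_eqVlt; apply/orP; left; apply/eqP.
by field; rewrite gt_eqF.
Qed.

Let K1 := 16 * Cz + C * (2 * u) + q^-1.

(** The lower bound uses the integer part n of the time with no slack, the upper
    bound uses n + 1 with slack a = r^2, for which
    exp(- q r^2) <= 1 / (q r^2). *)
Lemma first_passage_central (r t : R) : 1 + 4 * m <= r -> `|t| <= r ->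
  `|H (r ^+ 8) (r ^+ 8 / m + t * r ^+ 4) - ncdf (t / zeta)| <= K1 / r ^+ 2.
Proof.
move=> r0 tr; have mgt0 := m0.
set x := r ^+ 8; set s := x / m + t * r ^+ 4.
have rgt0 : 0 < r by lra.
have r1 : 1 <= r by lra.
have r2 : 0 < r ^+ 2 by rewrite exprn_gt0.
have s0 : 0 <= s.
  have t1 : - r <= t by move: tr; rewrite ler_norml => /andP[].
  have e : s = r ^+ 4 * (r ^+ 4 / m + t) by rewrite /s /x; field; rewrite gt_eqF.
  rewrite e mulr_ge0// ?exprn_ge0 ?(ltW rgt0)//.
  have : r <= r ^+ 4 / m.
    rewrite ler_pdivlMr// exprS ler_pM2l//.
    have : r * 1 <= r * r ^+ 2 by rewrite ler_pM2l// exprn_ege1.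
    by rewrite -exprS; lra.
  lra.
have [n1 n2] : (Num.truncn s)%:R <= s /\ s < (Num.truncn s).+1%:R.
  by apply/andP; exact: truncn_itv.
set n := Num.truncn s in n1 n2.
have n3 : n.+1%:R <= s + 1 by rewrite -natr1 lerD2r.
have n4 : s - 1 <= n%:R by move: n2; rewrite -natr1; lra.
have dn : `|n%:R - s| <= 1 by rewrite ler_norml; apply/andP; split; lra.
have dn' : `|n.+1%:R - s| <= 1 by rewrite ler_norml; apply/andP; split; lra.
have [k0 kinv kz] := normalized_gap_close r0 tr dn (lexx _) (ltW r2).
have [k0' kinv' kz'] := normalized_gap_close r0 tr dn' (ltW r2) (lexx _).
have lip (a b : R) : `|a - b| <= Cz / r ^+ 2 -> `|ncdf a - ncdf b| <= 16 * (Cz / r ^+ 2).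
  by move=> h; apply: (le_trans (ncdf_lip _ _)); rewrite ler_pM2l.
have Cy (y : R) : y <= 2 * u / r ^+ 2 -> C * y <= C * (2 * u / r ^+ 2).
  by move=> h; rewrite ler_wpM2l.
have K1E : K1 / r ^+ 2 = 16 * (Cz / r ^+ 2) + C * (2 * u / r ^+ 2) + q^-1 / r ^+ 2.
  by rewrite /K1; ring.
have q1 : 0 <= q^-1 / r ^+ 2 by rewrite divr_ge0 ?invr_ge0 ?(ltW q0) ?(ltW r2).
have eq : expR (- (q * r ^+ 2)) <= q^-1 / r ^+ 2.
  rewrite expRN -invfM lef_pV2 ?posrE ?expR_gt0 ?mulr_gt0//.
  by apply: le_trans (expR_ge1Dx _); rewrite lerDr.
have close (k : nat) (b P : R) :
    `|(k%:R * m - x + b) / (sigma * Num.sqrt k%:R) - t / zeta| <= Cz / r ^+ 2 ->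
    (Num.sqrt k%:R)^-1 <= 2 * u / r ^+ 2 ->
    `|P - ncdf ((x - b - k%:R * m) / (sigma * Num.sqrt k%:R))| <= C / Num.sqrt k%:R ->
    `|1 - P - ncdf (t / zeta)| <= 16 * (Cz / r ^+ 2) + C * (2 * u / r ^+ 2).
  move=> h1 h2.
  have -> : (x - b - k%:R * m) / (sigma * Num.sqrt k%:R) =
     - ((k%:R * m - x + b) / (sigma * Num.sqrt k%:R)).
    by rewrite -[RHS]mulNr; congr (_ * _); ring.
  rewrite ncdfN => h3; have := lip _ _ h1; have := Cy _ h2; move: h3.
  set z := ncdf _; set z0 := ncdf _; set A := C / _; set A' := C * _ => h3 h4 h5.
  rewrite (_ : 1 - P - z0 = (z - z0) - (P - (1 - z))); last by ring.
  apply: (le_trans (ler_normB _ _)); apply: lerD => //.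
  exact: le_trans h3 h4.
have lo : ncdf (t / zeta) - K1 / r ^+ 2 <= H x s.
  apply: le_trans (lower x n1).
  have := @clt n (x - 0) k0 => /(close _ _ _ kz kinv).
  rewrite subr0 ler_norml K1E => /andP[h _].
  by move: h q1; set a := 16 * _; set b := C * _; set e := _ / r ^+ 2; lra.
have hi : H x s <= ncdf (t / zeta) + K1 / r ^+ 2.
  apply: (le_trans (upper x (r ^+ 2) n2)).
  have := @clt n.+1 (x - r ^+ 2) k0' => /(close _ _ _ kz' kinv').
  rewrite ler_norml K1E => /andP[_ h].
  by move: h eq; set a := 16 * _; set b := C * _; set e := _ / r ^+ 2; lra.
by rewrite ler_norml; apply/andP; split; lra.
Qed.

(** For r < 1 + 4 m the bound is trivial, a difference of probabilities being at
    most 1 <= (1 + 4 m)^2 / r^2. *)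
Lemma first_passage_rate : exists2 k3 : R, 0 < k3 & forall x t : R, 1 <= x ->
  `|H x (x / m + t * Num.sqrt x) - ncdf (t / zeta)| <= k3 / x `^ 4^-1.
Proof.
have mgt0 := m0.
have Cz0 : 0 <= Cz.
  by rewrite /Cz divr_ge0 ?(ltW sigma0)// addr_ge0// !mulr_ge0 ?addr_ge0 ?exprn_ge0 ?(ltW u0).
have K10 : 0 <= K1.
  have Cu : 0 <= C * (2 * u) by rewrite !mulr_ge0 ?(ltW u0).
  have qi : 0 <= q^-1 by rewrite invr_ge0 ltW.
  by rewrite /K1; lra.
pose K2 := K1 + 8 * zeta ^+ 2.
have z20 : 0 <= 8 * zeta ^+ 2 by rewrite mulr_ge0// sqr_ge0.
have m20 : 0 < (1 + 4 * m) ^+ 2 by rewrite exprn_gt0//; lra.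
exists (K2 + (1 + 4 * m) ^+ 2); first by rewrite /K2; lra.
move=> x t x1; pose r := x `^ 8^-1.
have x0 : 0 < x by lra.
have r0 : 0 < r by rewrite powR_gt0.
have rk k : r ^+ k = x `^ (k%:R / 8).
  by rewrite -powR_mulrn ?ltW// -powRrM mulrC.
have r8 : r ^+ 8 = x by rewrite rk divff// powRr1// ltW.
have r4 : Num.sqrt x = r ^+ 4.
  by rewrite -r8 -[8%N]/(4 * 2)%N exprM sqrtr_sqr ger0_norm// exprn_ge0// ltW.
have r2 : x `^ 4^-1 = r ^+ 2 by rewrite rk; congr (_ `^ _); lra.
rewrite r2 r4 -r8.
have r20 : 0 < r ^+ 2 by rewrite exprn_gt0.
have H1 (t' : R) := H01 (r ^+ 8) (r ^+ 8 / m + t' * r ^+ 4).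
have [rsmall|rbig] := ltP r (1 + 4 * m).
  have : 1 <= (K2 + (1 + 4 * m) ^+ 2) / r ^+ 2.
    rewrite ler_pdivlMr// mul1r.
    have : r ^+ 2 <= (1 + 4 * m) ^+ 2 by rewrite lerXn2r ?nnegrE// ?ltW//; lra.
    by rewrite /K2; lra.
  apply: le_trans.
  have /andP[h1 h2] := H1 t; have h3 := ncdf_ge0 (t / zeta).
  have h4 := ncdf_le1 (t / zeta).
  by rewrite ler_norml; apply/andP; split; lra.
apply: (@le_trans _ _ (K2 / r ^+ 2)); last first.
  by rewrite ler_pM2r ?invr_gt0//; lra.
have K2E : K2 / r ^+ 2 = K1 / r ^+ 2 + 8 * zeta ^+ 2 / r ^+ 2 by rewrite /K2 mulrDl.
have e0 : 0 <= 8 * zeta ^+ 2 / r ^+ 2 by rewrite divr_ge0// ltW.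
have tail : ncdf (- (r / zeta)) <= 8 * zeta ^+ 2 / r ^+ 2.
  have rz : 0 < r / zeta by rewrite divr_gt0// zeta0.
  apply: (le_trans (ncdf_tail rz)).
  by rewrite expr_div_n invf_div mulrA.
move: K2E e0 tail; set e := 8 * _ / _; set K := K1 / _ => K2E e0 tail.
rewrite K2E.
have mono (t1 t2 : R) : t1 <= t2 ->
    H (r ^+ 8) (r ^+ 8 / m + t1 * r ^+ 4) <= H (r ^+ 8) (r ^+ 8 / m + t2 * r ^+ 4)
    /\ ncdf (t1 / zeta) <= ncdf (t2 / zeta).
  move=> t12; split.
    by apply: Hnd; rewrite lerD2l ler_wpM2r// exprn_ge0// ltW.
  by apply: ncdf_nd; rewrite ler_wpM2r// invr_ge0 ltW// zeta0.
have rr : `|r| <= r by rewrite ger0_norm// ltW.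
have Nrr : `|- r| <= r by rewrite normrN.
have [tr|tr] := leP `|t| r.
  by apply: (le_trans (first_passage_central rbig tr)); rewrite lerDl.
have /andP[h1 h2] := H1 t; have h3 := ncdf_ge0 (t / zeta).
have h4 := ncdf_le1 (t / zeta).
(* Beyond the central window, compare with t = r or t = - r by monotonicity: there
   both functions are within K + e of 1, respectively of 0. *)
have [t0|t0] := leP 0 t.
  have [|i1 i2] := mono r t; first by move: tr; rewrite ger0_norm// => /ltW.
  have := first_passage_central rbig rr; rewrite -/K => i3.
  have i4 : 1 - ncdf (r / zeta) <= e by rewrite -ncdfN.
  by move: i3; rewrite !ler_norml => /andP[i5 i6]; apply/andP; split; lra.
have [|i1 i2] := mono t (- r).
  by move: tr; rewrite ltr0_norm// ltrNr => /ltW.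
have := first_passage_central rbig Nrr; rewrite -/K => i3.
have i4 : ncdf (- r / zeta) <= e by rewrite mulNr.
by move: i3; rewrite !ler_norml => /andP[i5 i6]; apply/andP; split; lra.
Qed.

End renewal_inversion.

(** * The Levy process *)

Lemma process_sigmaP d (T : measurableType d) (R : realType) (X : R -> T -> R)
    (I : set R) (t : R) (A : set R) : I t -> measurable A ->
  process_sigma X I (X t @^-1` A).
Proof. by move=> It mA; apply: sub_sigma_algebra; exists t, A. Qed.

Lemma measurable_shift (R : realType) (A : set R) (b : R) : measurable A ->
  measurable [set y : R | A (y - b)].
Proof.
move=> mA; have h : measurable_fun [set: R] (fun y : R => y - b).
  exact: measurable_funB.
by have := h measurableT _ mA; rewrite setTI.
Qed.

Section decomposition.
Context d (T : measurableType d) (R : realType) (P : probability T R).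
Variables (X Bm J : R -> T -> R) (c : R).
Variable nu : {measure set (measurableTypeR R) -> \bar R}.
Hypothesis dec : levy_decomposition P X Bm c J nu.
Hypothesis expX : has_exponent P X c nu.
Variable delta : R.
Hypothesis delta_gt0 : 0 < delta.
Hypothesis delta_r : (delta%:E <= r_nu nu)%E.

Let LX : levy_process P X. Proof. by case: dec. Qed.
Let LB : levy_process P Bm. Proof. by case: dec => _ []. Qed.
Let LJ : levy_process P J. Proof. by case: dec => _ _ []. Qed.
Let XE t w : 0 <= t -> X t w = Bm t w - c * t + J t w.
Proof. by case: dec => _ _ _ _ h; exact: h. Qed.

Lemma brownian_law t (A : set R) : 0 < t -> measurable A ->
  P (Bm t @^-1` A) = normal_prob 0 (Num.sqrt t) A.
Proof. by case: dec => _ [_ _ h] _ _ _; exact: h. Qed.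

Lemma brownian_jump_indep s t (A B : set R) : 0 <= s -> 0 <= t ->
  measurable A -> measurable B ->
  P (J s @^-1` A `&` Bm t @^-1` B) = (P (J s @^-1` A) * P (Bm t @^-1` B))%E.
Proof.
move=> s0 t0 mA mB; have [_ _ _ ind _] := dec.
rewrite setIC muleC; apply: ind; apply: process_sigmaP => //.
  by rewrite /= in_itv/= andbT.
by rewrite /= in_itv/= andbT.
Qed.

Lemma exponent_finite (q t : R) : 0 <= t -> `|q| < delta ->
  (\int[P]_w (expR (- q * X t w))%:E = (expR (t * phi c nu q))%:E)%E.
Proof.
move=> t0 qd; rewrite -expX//; first by rewrite unlock.
rewrite lteNl; apply: lt_le_trans delta_r; rewrite -EFinN lte_fin.
by move: qd; rewrite ltr_norml => /andP[+ _]; rewrite ltrNl.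
Qed.

Lemma phi_at0 : phi c nu 0 = 0.
Proof.
have d0 : `|0 : R| < delta by rewrite normr0.
have := @exponent_finite 0 1 ler01 d0; rewrite mul1r.
under eq_integral => w _ do rewrite oppr0 mul0r expR0.
rewrite (integral_cst P measurableT 1%:E) [X in (_ * X)%E](@probability_setT _ _ _ P).
rewrite mule1 => -[].
by rewrite -expR0 => /expR_inj.
Qed.

Variable m : R.

(** The walk that remains at integer times when the Brownian part and the mean m
    of X_1 are removed: X_n = B_n + jump_walk n + n m. *)
Definition jump_walk (k : nat) (w : T) : R := J k%:R w - (c + m) * k%:R.

Lemma measurable_jump_walk k : measurable_fun setT (jump_walk k).
Proof.
by apply: measurable_funB => //; exact: (levy_measurable LJ).
Qed.

(** Integrating the independent Brownian part out of E exp(- q X_1) = exp(phi q)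
    leaves the factor exp(q^2/2) to be divided out. *)
Lemma jump_walk_mgf (q : R) : `|q| < delta ->
  (\int[P]_w (expR (- q * jump_walk 1 w))%:E =
    (expR (phi c nu q + m * q - 1 * q ^+ 2 / 2))%:E)%E.
Proof.
move=> qd.
have mJ1 := measurable_jump_walk 1.
have mB1 : measurable_fun setT (Bm 1) by exact: (levy_measurable LB).
have ind (A B : set R) : measurable A -> measurable B ->
    P (jump_walk 1 @^-1` A `&` Bm 1 @^-1` B) =
    (P (jump_walk 1 @^-1` A) * P (Bm 1 @^-1` B))%E.
  move=> mA mB.
  exact: (@brownian_jump_indep _ _ [set y | A (y - (c + m) * 1)] B ler01 ler01
    (measurable_shift _ mA) mB).
have mf : measurable_fun [set: R * R]
    (fun z : R * R => (expR (- q * z.1) * expR (- q * z.2))%:E).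
  apply/measurable_EFinP; apply: measurable_funM; apply: measurableT_comp => //.
    exact: measurable_funM.
  exact: measurable_funM.
have := @ge0_integral_indep _ _ _ P _ _ _
  (fun x y => (expR (- q * x) * expR (- q * y))%:E) mJ1 mB1 mB1 ind _ mf.
move=> /(_ _)/= e.
have lhs : (\int[P]_w (expR (- q * jump_walk 1 w) * expR (- q * Bm 1 w))%:E =
    (expR (phi c nu q + m * q))%:E)%E.
  transitivity ((expR (q * m))%:E * \int[P]_w (expR (- q * X 1 w))%:E)%E.
    rewrite -ge0_integralZl//.
    - apply: eq_integral => w _; rewrite -EFinM -!expRD; congr (expR _)%:E.
      by rewrite XE// /jump_walk; ring.
    - by apply: measurable_mgf_integrand; exact: (levy_measurable LX).
  by rewrite exponent_finite// mul1r -EFinM -expRD; congr (expR _)%:E; ring.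
have rhs : (\int[P]_w \int[P]_v (expR (- q * jump_walk 1 w) * expR (- q * Bm 1 v))%:E =
    \int[P]_w (expR (- q * jump_walk 1 w))%:E * (expR (q ^+ 2 / 2))%:E)%E.
  rewrite -ge0_integralZr//.
  - apply: eq_integral => w _; under eq_integral => v _ do rewrite EFinM.
    rewrite ge0_integralZl//.
    + rewrite gaussian_rv_mgf// => A mA.
      by rewrite brownian_law// sqrtr1.
    + exact: measurable_mgf_integrand.
  - exact: measurable_mgf_integrand.
have {}e : ((expR (phi c nu q + m * q))%:E =
    \int[P]_w (expR (- q * jump_walk 1 w))%:E * (expR (q ^+ 2 / 2))%:E)%E.
  by rewrite -rhs -e// => x y; rewrite lee_fin mulr_ge0 ?expR_ge0.
rewrite expRD EFinM e -muleA -EFinM -expRD.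
by rewrite mul1r subrr expR0 mule1.
Qed.

Lemma measurable_X1 : measurable_fun setT (X 1).
Proof. exact: (levy_measurable LX). Qed.

Lemma finite_X1 (q : R) : `|q| < delta -> (\int[P]_w (expR (- q * X 1 w))%:E < +oo)%E.
Proof. by move=> qd; rewrite exponent_finite// ltry. Qed.

Lemma finite_jump_walk (q : R) : `|q| < delta ->
  (\int[P]_w (expR (- q * jump_walk 1 w))%:E < +oo)%E.
Proof. by move=> qd; rewrite jump_walk_mgf// ltry. Qed.

Lemma phi_X (q : R) : `|q| < delta ->
  expR (phi c nu q + 0 * q - 0 * q ^+ 2 / 2) = mgf_deriv P (X 1) 0 q.
Proof.
move=> qd; apply: mgf_deriv0E; rewrite exponent_finite// !mul0r subr0 addr0 mul1r.
by [].
Qed.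

Lemma integrable_X1 : P.-integrable setT (EFin \o X 1).
Proof.
have d0 : `|0 : R| < delta by rewrite normr0.
have := integrableN (integrable_power_exp measurable_X1 finite_X1 1 d0).
apply: eq_integrable => // w _.
by rewrite /= /power_exp oppr0 mul0r expR0 mulr1 expr1 opprK.
Qed.

Lemma phi_derive_mean : (phi c nu)^`()%classic 0 = - \int[P]_w X 1 w.
Proof.
have [-> _] := log_mgf_derivatives delta_gt0 (fun q => is_derive_mgf_deriv measurable_X1 finite_X1 0 (q:=q))
  (fun q => is_derive_mgf_deriv measurable_X1 finite_X1 1 (q:=q)) phi_X phi_at0.
rewrite subr0 mgf_deriv_at0.
under eq_Rintegral do rewrite expr1.
rewrite -[RHS]mulN1r -RintegralZl//.
  by apply: eq_Rintegral => w _; rewrite mulN1r.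
exact: integrable_X1.
Qed.

Lemma phi_jump_walk (q : R) : `|q| < delta ->
  expR (phi c nu q + m * q - 1 * q ^+ 2 / 2) = mgf_deriv P (jump_walk 1) 0 q.
Proof. by move=> qd; apply: mgf_deriv0E; exact: jump_walk_mgf. Qed.

Lemma jump_walk_derivatives :
  (phi c nu)^`()%classic 0 = mgf_deriv P (jump_walk 1) 1 0 - m /\
  (phi c nu)^`(2)%classic 0 =
    mgf_deriv P (jump_walk 1) 2 0 - mgf_deriv P (jump_walk 1) 1 0 ^+ 2 + 1.
Proof.
have mJ1 := measurable_jump_walk 1.
exact: (log_mgf_derivatives delta_gt0 (fun q => is_derive_mgf_deriv mJ1 finite_jump_walk 0 (q:=q))
  (fun q => is_derive_mgf_deriv mJ1 finite_jump_walk 1 (q:=q)) phi_jump_walk phi_at0).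
Qed.

Lemma jump_walk_indep k (A B : set R) : measurable A -> measurable B ->
  P (jump_walk k @^-1` A `&` (jump_walk k.+1 \- jump_walk k) @^-1` B) =
  (P (jump_walk k @^-1` A) * P (jump_walk 1 @^-1` B))%E.
Proof.
move=> mA mB; have [_ _ _ ind stat] := LJ.
have k0 : 0 <= k%:R :> R by [].
have k1 : k%:R <= k.+1%:R :> R by rewrite ler_nat.
pose A' := [set y : R | A (y - (c + m) * k%:R)].
pose B' := [set y : R | B (y - (c + m) * 1)].
have mA' : measurable A' by exact: measurable_shift.
have mB' : measurable B' by exact: measurable_shift.
have sA : process_sigma J `[0, k%:R] (J k%:R @^-1` A').
  by apply: process_sigmaP => //; rewrite /= in_itv/= k0 lexx.
have := ind _ _ _ _ k0 k1 sA mB'.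
have := stat k%:R 1 B' k0 ler01 mB'; rewrite natr1 => ->.
have -> : (J k.+1%:R \- J k%:R) @^-1` B' = (jump_walk k.+1 \- jump_walk k) @^-1` B.
  apply/funext => w; rewrite /B' /preimage /jump_walk /=; congr (B _).
  by rewrite -natr1; ring.
by [].
Qed.

Hypothesis mE : (phi c nu)^`()%classic 0 = - m.
Let sigma2 := (phi c nu)^`(2)%classic 0.

(** phi'(0) = - m makes the walk centered, and phi''(0) - 1 is its variance per
    step; the normal approximation of X_n has therefore variance n phi''(0), of
    which n comes from the Brownian motion. *)
Lemma levy_berry_esseen : 1 <= sigma2 /\ exists2 C : R, 0 <= C &
  forall (n : nat) (y : R), (0 < n)%N ->
  `|fine (P [set w | X n%:R w <= y])
    - ncdf ((y - n%:R * m) / (Num.sqrt sigma2 * Num.sqrt n%:R))|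
    <= C / Num.sqrt n%:R.
Proof.
have mJ := measurable_jump_walk.
have d0 : `|0 : R| < delta by rewrite normr0.
have iM k : P.-integrable setT (EFin \o (fun w => (- jump_walk 1 w) ^+ k)).
  have := integrable_power_exp (mJ 1) finite_jump_walk k d0.
  apply: eq_integrable => // w _; congr EFin.
  by rewrite /power_exp oppr0 mul0r expR0 mulr1.
have iU2 : P.-integrable setT (EFin \o (fun w => jump_walk 1 w ^+ 2)).
  by have := iM 2; apply: eq_integrable => // w _; rewrite /= sqrrN.
have iU3 : P.-integrable setT (EFin \o (fun w => `|jump_walk 1 w| ^+ 3)).
  have := integrable_norm (iM 3); apply: eq_integrable => // w _.
  by rewrite /= normrX normrN.
have iU1 : P.-integrable setT (EFin \o jump_walk 1).
  have := integrableN (iM 1); apply: eq_integrable => // w _.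
  by rewrite /= expr1 opprK.
have [c1 c2] := jump_walk_derivatives.
have M1 : mgf_deriv P (jump_walk 1) 1 0 = 0 by move: c1; rewrite mE; lra.
have EU : \int[P]_w jump_walk 1 w = 0.
  apply/eqP; rewrite -oppr_eq0 -mulN1r -RintegralZl//; apply/eqP.
  rewrite -[RHS]M1 mgf_deriv_at0; apply: eq_Rintegral => w _.
  by rewrite mulN1r expr1.
pose tau := \int[P]_w (jump_walk 1 w ^+ 2).
have s2 : sigma2 = 1 + tau.
  rewrite /sigma2 c2 M1 expr0n/= subr0 addrC; congr (_ + _).
  by rewrite mgf_deriv_at0; apply: eq_Rintegral => w _; rewrite sqrrN.
have tau0 : 0 <= tau by exact: tau_ge0.
split; first by rewrite s2; lra.
have S0 w : jump_walk 0 w = 0.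
  have [_ J0 _ _ _] := LJ.
  by rewrite /jump_walk mulr0 subr0 J0.
exists (lindeberg_const P (jump_walk 1)); first exact: lindeberg_const_ge0.
move=> n y n0; have nn : 0 < n%:R :> R by rewrite ltr0n.
have -> : [set w | X n%:R w <= y] =
    [set w | jump_walk n w + Bm n%:R w <= y - n%:R * m].
  apply/funext => w; rewrite /mkset XE// /jump_walk; congr is_true.
  by apply/idP/idP; lra.
have mB : measurable_fun setT (Bm n%:R) by exact: (levy_measurable LB).
rewrite (@gaussian_sum_cdf _ _ _ P (jump_walk n) (Bm n%:R) (Num.sqrt n%:R))//.
- rewrite -sqrtrM; last by lra.
  rewrite s2 [(1 + tau) * _]mulrC.
  exact: (lindeberg (mJ 1) iU1 iU2 iU3 EU mJ S0 jump_walk_indep (y - n%:R * m) n0).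
- by rewrite sqrtr_gt0.
- by move=> A mA; exact: brownian_law.
- move=> A B mA mB'.
  exact: (@brownian_jump_indep _ _ [set z | A (z - (c + m) * n%:R)] B (ltW nn) (ltW nn)
    (measurable_shift _ mA) mB').
Qed.

(** Positive drift makes phi decrease at 0. *)
Lemma phi_nonpositive : 0 < m -> exists q, [/\ 0 < q, q < delta & phi c nu q <= 0].
Proof.
move=> mpos.
have d1 q qd := @is_derive_mgf_deriv _ _ _ _ _ _ measurable_X1 finite_X1 0 q qd.
have [c1 _] := log_mgf_derivatives delta_gt0 d1
  (fun q => is_derive_mgf_deriv measurable_X1 finite_X1 1 (q:=q)) phi_X phi_at0.
by apply: (log_mgf_nonpositive delta_gt0 d1 phi_X phi_at0); rewrite -c1 mE oppr_lt0.
Qed.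

End decomposition.

Lemma scaled_hitting_event (R : realType) (tau : \bar R) (x m t : R) : 0 < x -> 0 < m ->
  ((Num.sqrt x)^-1%:E * (tau + (x / - m)%:E) <= t%:E)%E =
  (tau <= (x / m + t * Num.sqrt x)%:E)%E.
Proof.
move=> x0 m0; have s0 : 0 < Num.sqrt x by rewrite sqrtr_gt0.
have si : (0 < (Num.sqrt x)^-1%:E)%E by rewrite lte_fin invr_gt0.
case: tau => [r| |].
- rewrite -EFinD -EFinM !lee_fin ler_pdivrMl// invrN mulrN lerBlDr.
  by rewrite [_ * t]mulrC addrC.
- by rewrite addye// gt0_muley// !leye_eq.
- by rewrite addNye gt0_muleNy// !leNye.
Qed.

Lemma fine_above d (T : measurableType d) (R : realType) (P : probability T R)
    (Y : T -> R) (x : R) : measurable [set w | Y w <= x] ->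
  fine (P [set w | x < Y w]) = 1 - fine (P [set w | Y w <= x]).
Proof.
move=> mY; have -> : [set w | x < Y w] = ~` [set w | Y w <= x].
  by apply/seteqP; split => w /=; rewrite ltNge => /negP.
by rewrite probability_setC// fineB// fin_num_measure.
Qed.

Theorem mainTheorem5 (d : measure_display) (T : measurableType d)
    (R : realType) (P : probability T R)
    (X Bm J : R -> T -> R) (c : R)
    (nu : {measure set (measurableTypeR R) -> \bar R})
    (nuhat phihat : merofun R) (B kappa : R) (gamma0 : R -> R) :
  levy_measure nu ->
  levy_decomposition P X Bm c J nu ->
  has_exponent P X c nu ->
  (0 < r_nu nu)%E ->
  r_nu_star nu = +oo%E ->
  meromorphic_extension (half_plane (r_nu nu)) (laplace_ge1 nu)
    (half_plane (B_nu nu)) nuhat ->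
  meromorphic_extension (half_plane (r_nu nu)) (cphi c nu)
    (half_plane (B_nu nu)) phihat ->
  growth_condition nu nuhat ->
  0 < B -> (B%:E < B_nu nu)%E -> 0 < kappa ->
  zero_condition c nu phihat ('E_P[X 1%R])%E B kappa gamma0 ->
  (0 < 'E_P[X 1%R])%E ->
  let dphi := (phi c nu)^`()%classic (- gamma0 0) in
  let ddphi := (phi c nu)^`(2)%classic (- gamma0 0) in
  let A_ (x t : R) := fine (P [set w |
    ((Num.sqrt x)^-1%:E * (hitting_time X x w + (x / dphi)%:E) <= t%:E)%E]) in
  let A (t : R) :=
    fine (normal_prob 0 (Num.sqrt (- (ddphi / dphi ^+ 3))) `]-oo, t]) in
  exists2 k3 : R, 0 < k3 & forall x : R, 1 <= x ->
    (ereal_sup [set `|A_ x t - A t|%:E | t in [set: R]] <=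
       (k3 / x `^ 4^-1)%:E)%E.
Proof.
move=> _ dec expX r0 _ _ _ _ _ _ kappa0 [p zc] EX.
have LX : levy_process P X by case: dec.
have -> : - gamma0 0 = 0.
  have [|_ [_ _ h] _] := zc 0; first by rewrite lexx ltW.
  exact: h (ltW EX).
move=> dphi ddphi A_ A.
have [delta delta0 deltar] : exists2 e : R, 0 < e & (e%:E <= r_nu nu)%E.
  case: (r_nu nu) r0 => [r| |] //; first by rewrite lte_fin => ?; exists r.
  by move=> _; exists 1; rewrite ?ltr01 ?leey.
pose m := \int[P]_w X 1 w.
have iX := integrable_X1 dec expX delta0 deltar.
have dE : dphi = - m by exact: (phi_derive_mean dec expX delta0 deltar).
have m0 : 0 < m.
  rewrite -lte_fin /m /Rintegral fineK; last exact: integrable_fin_num iX.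
  by move: EX; rewrite unlock.
have [s21 [C C0 clt]] := levy_berry_esseen dec expX delta0 deltar dE.
have [q [q0 qd phiq]] := phi_nonpositive dec expX delta0 deltar dE m0.
have expq t : 0 <= t -> ('E_P[fun w => expR (- q * X t w)%R])%E = (expR (t * phi c nu q))%:E.
  move=> t0; apply: expX => //; apply: (@lt_trans _ _ 0%E).
    by rewrite oppe_lt0.
  by rewrite lte_fin.
pose H x s := fine (P [set w | (hitting_time X x w <= s%:E)%E]).
have mH x s : measurable [set w | (hitting_time X x w <= s%:E)%E].
  exact: (measurable_hitting LX).
have mX n y : measurable [set w | X n%:R w <= y] by exact: (measurable_below LX).
have finP (E : set T) : measurable E -> P E \is a fin_num.
  by move=> mE; rewrite fin_num_measure.
have dd0 : 0 < ddphi := lt_le_trans ltr01 s21.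
have sigma0 : 0 < Num.sqrt ddphi by rewrite sqrtr_gt0.
have lower n x s : n%:R <= s -> 1 - fine (P [set w | X n%:R w <= x]) <= H x s.
  move=> ns; rewrite -fine_above//; apply: fine_le; rewrite ?finP//.
    exact: (measurable_above LX).
  exact: (hitting_lower LX).
have upper n x s a : s < n%:R ->
    H x s <= 1 - fine (P [set w | X n%:R w <= x - a]) + expR (- (q * a)).
  move=> sn; have := hitting_upper LX q0 phiq expq x a sn.
  have mA : measurable [set w | x - a < X n%:R w] by exact: (measurable_above LX).
  rewrite -[P [set w | hitting_time _ _ _ <= _]%E]fineK ?finP//.
  by rewrite -[P [set w | _ < _]]fineK ?finP// -EFinD lee_fin fine_above.
have H01 x s : 0 <= H x s <= 1.
  by rewrite fine_ge0//= -lee_fin fineK ?finP// probability_le1.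
have Hnd x s s' : s <= s' -> H x s <= H x s'.
  move=> ss; apply: fine_le; rewrite ?finP//; apply: le_measure; rewrite ?inE//.
  by move=> w /= /le_trans; apply; rewrite lee_fin.
have [k k0 bound] := first_passage_rate m0 sigma0 C0 q0 clt lower upper H01 Hnd.
exists k => // x x1; apply: ub_ereal_sup => _ [t _ <-]; rewrite lee_fin.
have x0 : 0 < x by lra.
have -> : A_ x t = H x (x / m + t * Num.sqrt x).
  rewrite /A_ /H dE; congr (fine (P _)); apply/funext => w.
  by rewrite /mkset scaled_hitting_event.
have -> : A t = ncdf (t / Num.sqrt (Num.sqrt ddphi ^+ 2 / m ^+ 3)).
  have z0 : 0 < Num.sqrt (Num.sqrt ddphi ^+ 2 / m ^+ 3).
    by rewrite sqrtr_gt0 divr_gt0// exprn_gt0.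
  have se : - (ddphi / dphi ^+ 3) = Num.sqrt ddphi ^+ 2 / m ^+ 3.
    rewrite sqr_sqrtr; last exact: ltW.
    by rewrite dE; field; rewrite gt_eqF.
  by rewrite /A se normal_prob_scale.
exact: bound.
Qed.
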